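(* Let $n\ge 1$ and let $f:\mathbb{R}^n\to\mathbb{R}$ be a radial Cohn–Elkies function, with $r:=r(f)=R(n)$. Let $S\subseteq\mathbb{R}^n$ be a compact set with Lebesgue measure $\mu(S)>1$. Then: (1) there exists $z\in (S-S)$ with $\|z\|\ge r$ and $f(z)=0$; (2) there exists $z'\in S-S$ with $\hat f(z')=0$.
   Context: The Fourier transform is normalized as $\hat f(\xi)=\int_{\mathbb{R}^n} f(x)e^{-2\pi i \xi\cdot x}\,dx$. A function $f:\mathbb{R}^n\to\mathbb{R}$ is called acceptable if it is even and $f,\hat f\in L^1(\mathbb{R}^n)$ (so $f,\hat f$ are continuous). $\mathcal{F}_n$ denotes the set of acceptable $f:\mathbb{R}^n\to\mathbb{R}$ with $f(0)=\hat f(0)>0$, $\hat f(\xi)\ge 0$ for all $\xi$, and such that there is some $r>0$ with $f(x)\le 0$ whenever $\|x\|\ge r$. For $f\in\mathcal{F}_n$, $r(f):=\inf\{r\in\mathbb{R}: f(x)\le 0 \text{ for all } \|x\|\ge r\}$, and $R(n):=\inf_{f\in\mathcal{F}_n} r(f)$. A Cohn–Elkies function is an $f\in\mathcal{F}_n$ with $r(f)=R(n)$. A function is radial if $f(x)$ depends only on $\|x\|$. For $A,B\subseteq\mathbb{R}^n$, $A-B:=\{a-b: a\in A, b\in B\}$; $\mu$ is Lebesgue measure. *)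

(* Defs.v *)
From HB Require Import structures.
From mathcomp Require Import all_boot all_order all_algebra.
From mathcomp Require Import all_classical all_reals all_analysis.
From mathcomp Require Import complex.
Set Implicit Arguments. Unset Strict Implicit. Unset Printing Implicit Defensive.
Import numFieldNormedType.Exports.
Import Order.TTheory GRing.Theory Num.Theory.
Local Open Scope classical_set_scope. Local Open Scope ring_scope. Local Open Scope ereal_scope.
Section ProdSigmaFinite.
Context d1 d2 (T1 : measurableType d1) (T2 : measurableType d2) (R : realType).
Variable m1 : {sigma_finite_measure set T1 -> \bar R}.
Variable m2 : {sigma_finite_measure set T2 -> \bar R}.
Definition pmeas := (m1 \x m2)%E.
HB.instance Definition _ := Measure.on pmeas.
Lemma pmeas_sigma_finite : sigma_finite setT pmeas.
Proof.
have /sigma_finiteP[F [TF ndF Foo]] := sigma_finiteT m1.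
have /sigma_finiteP[G [TG ndG Goo]] := sigma_finiteT m2.
exists (fun n => F n `*` G n).
 rewrite -setXTT TF TG predeqE => -[x y]; split.
    move=> [/= [n _ Fnx] [k _ Gky]]; exists (maxn n k) => //; split.
    - by move: x Fnx; exact/subsetPset/ndF/leq_maxl.
    - by move: y Gky; exact/subsetPset/ndG/leq_maxr.
  by move=> [n _ []/= ? ?]; split; exists n.
move=> k; have [? ?] := Foo k; have [? ?] := Goo k.
split; first exact: measurableX.
by rewrite /pmeas product_measure1E// lte_mul_pinfty// ge0_fin_numE.
Qed.
HB.instance Definition _ := Measure_isSigmaFinite.Build _ _ _ pmeas pmeas_sigma_finite.
End ProdSigmaFinite.

(* Lebesgue measure on R^(n+1), built as the iterated product          *)
(*   lebesgue \x (lebesgue \x ( ... \x lebesgue))   (n+1 factors).     *)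
(* The carrier of [lspace R n] is R * (R * ( ... * R)).                *)
Record LSpace (R : realType) := LSpaceBuild {
  ls_d : measure_display;
  ls_T : measurableType ls_d;
  ls_mu : {sigma_finite_measure set ls_T -> \bar R} }.

Fixpoint lspace (R : realType) (n : nat) : LSpace R :=
  match n with
  | 0 => @LSpaceBuild R _ (measurableTypeR R) (@lebesgue_measure R)
  | k.+1 => @LSpaceBuild R _ (measurableTypeR R * ls_T (lspace R k))%type
              (@pmeas _ _ _ _ R (@lebesgue_measure R) (ls_mu (lspace R k)))
  end.

Fixpoint vec (R : realType) (n : nat) : ls_T (lspace R n) -> 'rV[R]_n.+1 :=
  match n return ls_T (lspace R n) -> 'rV[R]_n.+1 with
  | 0 => fun x => const_mx x
  | k.+1 => fun p => row_mx (const_mx p.1 : 'rV[R]_1) (@vec R k p.2)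
  end.

Local Close Scope ereal_scope.

Definition leb (R : realType) (n : nat) (A : set 'rV[R]_n.+1) : \bar R :=
  ls_mu (lspace R n) (@vec R n @^-1` A).

Definition L1 (R : realType) (n : nat) (g : 'rV[R]_n.+1 -> R) : Prop :=
  (ls_mu (lspace R n)).-integrable setT (fun x => (g (@vec R n x))%:E).

Definition integ (R : realType) (n : nat) (g : 'rV[R]_n.+1 -> R) : R :=
  Rintegral (ls_mu (lspace R n)) setT (fun x => g (@vec R n x)).

Definition L1c (R : realType) (n : nat) (g : 'rV[R]_n.+1 -> R[i]) : Prop :=
  L1 (fun x => complex.Re (g x)) /\ L1 (fun x => complex.Im (g x)).

Definition dotv (R : realType) (n : nat) (x y : 'rV[R]_n) : R :=
  \sum_(i < n) x ord0 i * y ord0 i.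
Definition enorm (R : realType) (n : nat) (x : 'rV[R]_n) : R :=
  Num.sqrt (dotv x x).

(* Fourier transform  \hat f(xi) = \int f(x) e^{-2 pi i xi.x} dx
   = \int f(x) cos(2 pi xi.x) dx - i \int f(x) sin(2 pi xi.x) dx *)
Definition fourier (R : realType) (n : nat) (f : 'rV[R]_n.+1 -> R)
  (xi : 'rV[R]_n.+1) : R[i] :=
  ((integ (fun x => f x * cos (2 * pi * dotv xi x)))%:C
   - 'i * (integ (fun x => f x * sin (2 * pi * dotv xi x)))%:C)%C.

(* acceptable functions: even, f and \hat f in L^1; f is taken continuous
   (the continuous representative) *)
Definition acceptable (R : realType) (n : nat) (f : 'rV[R]_n.+1 -> R) : Prop :=
  [/\ continuous f, (forall x, f (- x) = f x), L1 f & L1c (fourier f)].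

Definition inF (R : realType) (n : nat) (f : 'rV[R]_n.+1 -> R) : Prop :=
  [/\ acceptable f,
      ((f 0)%:C)%C = fourier f 0, 0 < f 0,
      (forall xi, 0 <= fourier f xi)
    & exists2 r, 0 < r & forall x, r <= enorm x -> f x <= 0].

Definition rf (R : realType) (n : nat) (f : 'rV[R]_n.+1 -> R) : R :=
  inf [set r : R | forall x, r <= enorm x -> f x <= 0].

Definition Rdim (R : realType) (n : nat) : R :=
  inf [set rf f | f in [set f : 'rV[R]_n.+1 -> R | inF f]].

Definition cohn_elkies (R : realType) (n : nat) (f : 'rV[R]_n.+1 -> R) : Prop :=
  inF f /\ rf f = Rdim R n.

Definition radial (R : realType) (n : nat) (f : 'rV[R]_n -> R) : Prop :=
  forall x y, enorm x = enorm y -> f x = f y.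

Definition setdiffs (R : realType) (n : nat) (A B : set 'rV[R]_n) : set 'rV[R]_n :=
  [set z | exists a b, [/\ A a, B b & z = a - b]].

(* Main.v *)
Require Import Defs.
From HB Require Import structures.
From mathcomp Require Import all_boot all_order all_algebra.
From mathcomp Require Import all_classical all_reals all_analysis.
From mathcomp Require Import measurable_realfun complex ring lra.
Set Implicit Arguments. Unset Strict Implicit. Unset Printing Implicit Defensive.
Import numFieldNormedType.Exports.
Import Order.TTheory GRing.Theory Num.Theory.
Local Open Scope classical_set_scope.
Local Open Scope ring_scope.

(** Perturb f by an autocorrelation. Cover S by the m cubes of a fine grid of
    side d that meet S; since the measure of S exceeds 1, m d^N > 1 with
    N = n + 1. Let H be the autocorrelation of the indicator of the union of
    these cubes, divided by d^N: it is the sum, over pairs of cubes (a, b) with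
    corners c_a and c_b, of the product tents of half-width d centred at
    c_a - c_b. Then H >= 0 is supported near S - S, its Fourier transform is
    H^ = (product of sinc^2) * |sum_a e^(-2 pi i c_a.xi)|^2 >= 0, and
    H(0) = m < m^2 d^N = H^(0).
    If f had no zero of norm >= r in S - S, then f + k H, for small k > 0, would
    have the same sign properties as f and a strictly larger Fourier transform
    than value at 0; rescaling x -> l x with l > 1 restores the equality at 0 and
    decreases r, contradicting minimality. If f^ had no zero on S - S, the same
    argument applies to f - k H^, whose Fourier transform is f^ - k H.
    Inversion for the pair tent / sinc^2 is explicit and reduces to
    int_R (1 - cos t) / t^2 dt = pi, which follows from Tonelli and
    1 / t^2 = int_0^oo s e^(-s t) ds. *)

(** * Affine changes of variable *)

(** A change-of-variables formula with constant Jacobian. Taking nonnegative extended-valued [G]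
    lets it pass through Tonelli without any integrability condition. *)
Definition scales_integral {d} {T : measurableType d} {R : realType}
    (mu : {measure set T -> \bar R}) (phi : T -> T) (k : R) : Prop :=
  [/\ measurable_fun setT phi, 0 < k &
    forall G : T -> \bar R, measurable_fun setT G -> (forall x, 0 <= G x)%E ->
      (\int[mu]_x G (phi x) = k%:E * \int[mu]_x G x)%E].

Lemma scales_integrable {d} {T : measurableType d} {R : realType}
    (mu : {measure set T -> \bar R}) phi k (F : T -> R) :
  scales_integral mu phi k ->
  mu.-integrable setT (EFin \o F) -> mu.-integrable setT (EFin \o (F \o phi)).
Proof.
move=> [mphi k0 h] /integrableP[mF iF].
apply/integrableP; split; first exact: (measurableT_comp mF mphi).
rewrite [ltLHS](h (fun x => `|(EFin \o F) x|)%E)//; last first.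
  exact: measurableT_comp.
by rewrite lte_mul_pinfty// lee_fin ltW.
Qed.

Lemma scales_Rintegral {d} {T : measurableType d} {R : realType}
    (mu : {measure set T -> \bar R}) phi k (F : T -> R) :
  scales_integral mu phi k -> mu.-integrable setT (EFin \o F) ->
  Rintegral mu setT (F \o phi) = k * Rintegral mu setT F.
Proof.
move=> sphi iF; have iFphi := scales_integrable sphi iF.
have [mphi k0 h] := sphi.
have mF := measurable_int _ iF.
rewrite /Rintegral integralE [in RHS]integralE.
have -> : (\int[mu]_x ((fun x => ((F \o phi) x)%:E)^\+ x) =
    k%:E * \int[mu]_x ((fun x => (F x)%:E)^\+ x))%E.
  rewrite -h//; last exact: measurable_funepos.
  by apply: eq_integral => x _; rewrite !funeposE.
have -> : (\int[mu]_x ((fun x => ((F \o phi) x)%:E)^\- x) =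
    k%:E * \int[mu]_x ((fun x => (F x)%:E)^\- x))%E.
  rewrite -h//; last exact: measurable_funeneg.
  by apply: eq_integral => x _; rewrite !funenegE.
have fp := integrable_pos_fin_num measurableT iF.
have fn := integrable_neg_fin_num measurableT iF.
rewrite -muleBr//; last by rewrite fin_num_adde_defr.
by rewrite fineM// fin_numB fp fn.
Qed.

(** Tonelli reduces the claim to the two factors in turn; this is the induction step on the
    dimension. *)
Lemma scales_prod {d1 d2} {T1 : measurableType d1} {T2 : measurableType d2}
    {R : realType} (m1 : {sigma_finite_measure set T1 -> \bar R})
    (m2 : {sigma_finite_measure set T2 -> \bar R}) phi1 phi2 k1 k2 :
  scales_integral m1 phi1 k1 -> scales_integral m2 phi2 k2 ->
  scales_integral (pmeas m1 m2) (fun p => (phi1 p.1, phi2 p.2)) (k1 * k2).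
Proof.
move=> [mphi1 k10 h1] [mphi2 k20 h2].
have mphi : measurable_fun setT (fun p : T1 * T2 => (phi1 p.1, phi2 p.2)).
  by apply: measurable_fun_pair; apply: measurableT_comp.
split => // [|G mG G0]; first exact: mulr_gt0.
rewrite (fubini_tonelli1 (fun p => G (phi1 p.1, phi2 p.2)))//; last first.
  exact: (measurableT_comp mG mphi).
rewrite (fubini_tonelli1 G)//.
transitivity (\int[m1]_x (k2%:E * fubini_F m2 G (phi1 x)))%E.
  apply: eq_integral => x _; rewrite /fubini_F /=.
  rewrite -(h2 (fun y => G (phi1 x, y)))//.
  exact: measurableT_comp.
have F0 x : (0 <= fubini_F m2 G x)%E by apply: integral_ge0.
have mF := measurable_fun_fubini_tonelli_F (m2 := m2) _ mG G0.
rewrite ge0_integralZl//; last 2 first.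
- exact: (measurableT_comp mF mphi1).
- by rewrite lee_fin ltW.
by rewrite h1// muleA EFinM [(k1%:E * _)%E]muleC.
Qed.

(** The pushforward of Lebesgue measure by the affine map, multiplied by [|l|], gives every interval
    []a, b]] its length, so it is Lebesgue measure by uniqueness. *)
Lemma lebesgue_scales {R : realType} (l c : R) : l != 0 ->
  scales_integral (@lebesgue_measure R) (fun x => l * x + c) (`|l|^-1).
Proof.
move=> l0.
pose phi : measurableTypeR R -> measurableTypeR R := fun x => l * x + c.
have mphi : measurable_fun setT phi.
  by apply: measurable_funD => //; apply: measurable_funM.
split => //; first by rewrite invr_gt0 normr_gt0.
move=> G mG G0.
have nl0 : 0 <= `|l| by [].
have [nu nuE] : exists nu : {measure set (measurableTypeR R) -> \bar R},
    (nu : set _ -> \bar R) = pushforward lebesgue_measure phi.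
  by unshelve eexists (pushforward lebesgue_measure phi).
transitivity (\int[nu]_x G x)%E.
  by rewrite nuE ge0_integral_pushforward.
have key A : measurable A -> lebesgue_measure A = mscale (NngNum nl0) nu A.
  move=> mA.
  apply: lebesgue_measure_unique => // _ [[a b]] _ <-.
  change (lebesgue_measure `]a, b]%classic =
    `|l|%:E * nu `]a, b]%classic)%E.
  have -> : nu `]a, b]%classic = lebesgue_measure (phi @^-1` `]a, b]%classic).
    by rewrite nuE.
  have /orP[lp|ln] : (0 < l) || (l < 0) by rewrite orbC -neq_lt.
  - rewrite (_ : _ @^-1` _ = `](a - c) / l, (b - c) / l]%classic); last first.
      apply/seteqP; split => x /=;
      rewrite /phi !in_itv/= ler_pdivlMr// ltr_pdivrMr// mulrC => /andP[? ?];
      by apply/andP; split; lra.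
    rewrite !lebesgue_measure_itv/= !lte_fin ltr_pM2r ?invr_gt0// ltrD2r.
    case: ifPn => _; last by rewrite mule0.
    rewrite gtr0_norm// -EFinM; congr EFin.
    by field.
  (* A negative slope exchanges the endpoints, so the preimage is closed on the left and open on the
     right. *)
  - rewrite (_ : _ @^-1` _ = `[(b - c) / l, (a - c) / l[%classic); last first.
      apply/seteqP; split => x /=;
      rewrite /phi !in_itv/= ler_ndivrMr// ltr_ndivlMr// mulrC => /andP[? ?];
      by apply/andP; split; lra.
    rewrite !lebesgue_measure_itv/= !lte_fin ltr_nM2r ?invr_lt0// ltrD2r.
    case: ifPn => _; last by rewrite mule0.
    rewrite ltr0_norm// -EFinM; congr EFin.
    by field.
have -> : (\int[lebesgue_measure]_x G x = \int[mscale (NngNum nl0) nu]_x G x)%E.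
  by apply: eq_measure_integral => A mA _; exact: key.
rewrite ge0_integral_mscale//= muleA -EFinM mulVf ?normr_eq0// mul1e.
by [].
Qed.

(** * Coordinates on the iterated product and affine maps of row vectors *)

Fixpoint unvec (R : realType) (n : nat) : 'rV[R]_n.+1 -> ls_T (lspace R n) :=
  match n return 'rV[R]_n.+1 -> ls_T (lspace R n) with
  | 0 => fun v => v ord0 ord0
  | k.+1 => fun v => (v ord0 ord0, @unvec R k (\row_j v ord0 (lift ord0 j)))
  end.

Lemma vecS0 (R : realType) n (p : ls_T (lspace R n.+1)) : vec p ord0 ord0 = p.1.
Proof.
rewrite /vec -/vec; have -> : ord0 = lshift n.+1 ord0 :> 'I_(1 + n.+1) by apply/val_inj.
by rewrite (row_mxEl (const_mx p.1 : 'rV_1)) mxE.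
Qed.

Lemma vecSl (R : realType) n (p : ls_T (lspace R n.+1)) j :
  vec p ord0 (lift ord0 j) = vec p.2 ord0 j.
Proof.
rewrite /vec -/vec; have -> : lift ord0 j = rshift 1 j :> 'I_(1 + n.+1) by apply/val_inj.
by rewrite (row_mxEr (const_mx p.1 : 'rV_1)).
Qed.

Lemma unvecK (R : realType) n : cancel (@unvec R n) (@vec R n).
Proof.
elim: n => [|n IH] v.
  by apply/rowP => j; rewrite /= mxE (ord1 j).
apply/rowP => j; case: (unliftP ord0 j) => [k ->|->].
  by rewrite vecSl /= IH mxE.
by rewrite vecS0.
Qed.

Lemma measurable_coord (R : realType) n (i : 'I_n.+1) :
  measurable_fun setT (fun x : ls_T (lspace R n) => vec x ord0 i : R).
Proof.
elim: n i => [|n IH] i.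
  rewrite (_ : (fun _ => _) = id) //.
  by apply/funext => x; rewrite /= mxE.
case: (unliftP ord0 i) => [k ->|->].
  rewrite (_ : (fun _ => _) = (fun y => vec y ord0 k : R) \o snd).
    by apply: measurableT_comp => //; exact: IH.
  by apply/funext => x; rewrite vecSl.
rewrite (_ : (fun _ => _) = fst) //.
by apply/funext => x; rewrite vecS0.
Qed.

Definition affine (R : realType) n (l : R) (c : 'rV[R]_n.+1)
  (x : ls_T (lspace R n)) : ls_T (lspace R n) := unvec (l *: vec x + c).

Lemma vec_affine (R : realType) n l c x :
  vec (@affine R n l c x) = l *: vec x + c.
Proof. by rewrite unvecK. Qed.

(** The map acts separately on the first coordinate and on the remaining ones, and each coordinate
    contributes one factor [|l|^-1]. *)
Lemma affine_scales (R : realType) n (l : R) (c : 'rV[R]_n.+1) : l != 0 ->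
  scales_integral (ls_mu (lspace R n)) (affine l c) (`|l| ^- n.+1).
Proof.
move=> l0; elim: n c => [|n IH] c.
  rewrite (_ : affine l c = (fun x => l * x + c ord0 ord0)).
    by rewrite expr1; exact: lebesgue_scales.
  by apply/funext => x; rewrite /affine /= !mxE.
rewrite exprS invfM.
rewrite (_ : affine l c = fun p : ls_T (lspace R n.+1) => (l * p.1 + c ord0 ord0,
    affine l (\row_j c ord0 (lift ord0 j)) p.2)).
  exact: (@scales_prod _ _ (measurableTypeR R) (ls_T (lspace R n)) R
    lebesgue_measure (ls_mu (lspace R n)) (fun x : measurableTypeR R => l * x + c ord0 ord0)
    _ _ _ (lebesgue_scales (c ord0 ord0) l0) (IH _)).
apply/funext => p; rewrite /affine [LHS]/unvec -/unvec.
congr (_, unvec _); first by rewrite mxE [X in X + _]mxE vecS0.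
apply/rowP => j; rewrite mxE mxE [X in X + _]mxE vecSl.
by rewrite [RHS]mxE [X in _ = X + _]mxE [X in _ = _ + X]mxE.
Qed.

(** * Cosine and sine transforms *)

Lemma prod_integrable {d1 d2} {T1 : measurableType d1} {T2 : measurableType d2}
    {R : realType} (m1 : {sigma_finite_measure set T1 -> \bar R})
    (m2 : {sigma_finite_measure set T2 -> \bar R}) (a : T1 -> R) (b : T2 -> R) :
  m1.-integrable setT (EFin \o a) -> m2.-integrable setT (EFin \o b) ->
  (pmeas m1 m2).-integrable setT (fun p => (a p.1 * b p.2)%:E).
Proof.
move=> ia ib.
have ma : measurable_fun setT a by apply/measurable_EFinP; exact: (measurable_int _ ia).
have mb : measurable_fun setT b by apply/measurable_EFinP; exact: (measurable_int _ ib).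
have mab : measurable_fun setT (fun p : T1 * T2 => (a p.1 * b p.2)%:E).
  apply/measurable_EFinP; apply: measurable_funM.
    exact: measurableT_comp.
  exact: measurableT_comp.
apply/(integrable12ltyP m1 m2 mab).
have [_ fa] := integrableP _ _ _ ia.
have [_ fb] := integrableP _ _ _ ib.
have -> : (\int[m1]_x \int[m2]_y `|(a x * b y)%:E| =
    (\int[m1]_x `|(a x)%:E|) * \int[m2]_y `|(b y)%:E|)%E.
  transitivity (\int[m1]_x (`|(a x)%:E| * \int[m2]_y `|(b y)%:E|))%E.
    apply: eq_integral => x _.
    rewrite -ge0_integralZl//; last by apply: measurableT_comp => //; exact/measurable_EFinP.
    by apply: eq_integral => y _; rewrite EFinM abseM.
  rewrite ge0_integralZr//; last exact: integral_ge0.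
  by apply: measurableT_comp => //; exact/measurable_EFinP.
have h x y : (0 <= x -> x < +oo -> y < +oo -> x * y < +oo :> \bar R)%E.
  move=> x0 xoo yoo; case: x x0 xoo => [x| |]// x0 _.
  exact: lte_mul_pinfty.
by apply: h => //; exact: integral_ge0.
Qed.

Lemma prod_Rintegral {d1 d2} {T1 : measurableType d1} {T2 : measurableType d2}
    {R : realType} (m1 : {sigma_finite_measure set T1 -> \bar R})
    (m2 : {sigma_finite_measure set T2 -> \bar R}) (a : T1 -> R) (b : T2 -> R) :
  m1.-integrable setT (EFin \o a) -> m2.-integrable setT (EFin \o b) ->
  Rintegral (pmeas m1 m2) setT (fun p => a p.1 * b p.2) =
  Rintegral m1 setT a * Rintegral m2 setT b.
Proof.
move=> ia ib.
have iab := prod_integrable ia ib.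
rewrite {1}/Rintegral -(integral12_prod_meas1 iab) /fubini_F.
transitivity (fine (\int[m1]_x ((a x)%:E * \int[m2]_y (b y)%:E))%E).
  congr fine; apply: eq_integral => x _.
  rewrite -integralZl//.
have fa := integrable_fin_num measurableT ia.
have fb := integrable_fin_num measurableT ib.
rewrite /Rintegral -fineM//; congr fine.
rewrite -(fineK fb) integralZr//.
Qed.

Section L1_theory.
Context {R : realType} {n : nat}.
Implicit Types (f g : 'rV[R]_n.+1 -> R) (xi c : 'rV[R]_n.+1).
Local Notation mu := (ls_mu (lspace R n)).

Lemma L1D f g : L1 f -> L1 g -> L1 (fun x => f x + g x).
Proof. by move=> Lf Lg; apply: eq_integrable (integrableD _ Lf Lg). Qed.

Lemma L1Z k f : L1 f -> L1 (fun x => k * f x).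
Proof. by move=> Lf; apply: eq_integrable (integrableZl _ k Lf). Qed.

Lemma integD f g : L1 f -> L1 g -> integ (fun x => f x + g x) = integ f + integ g.
Proof. by move=> Lf Lg; rewrite /integ RintegralD. Qed.

Lemma integZ k f : L1 f -> integ (fun x => k * f x) = k * integ f.
Proof. by move=> Lf; rewrite /integ RintegralZl. Qed.

Lemma L1_sum (I : Type) (s : seq I) (P : pred I) (F : I -> 'rV[R]_n.+1 -> R) :
  (forall i, P i -> L1 (F i)) -> L1 (fun x => \sum_(i <- s | P i) F i x).
Proof.
move=> LF.
apply: eq_integrable (integrable_sum _ s LF) => //.
by move=> x _; rewrite sumEFin.
Qed.

Lemma integ_sum (I : Type) (s : seq I) (P : pred I) (F : I -> 'rV[R]_n.+1 -> R) :
  (forall i, P i -> L1 (F i)) ->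
  integ (fun x => \sum_(i <- s | P i) F i x) = \sum_(i <- s | P i) integ (F i).
Proof.
move=> LF; elim: s => [|i s IH].
  rewrite big_nil; under [X in integ X]eq_fun do rewrite big_nil.
  by rewrite /integ Rintegral_cst// mul0r.
rewrite big_cons; under [X in integ X]eq_fun do rewrite big_cons.
case: ifPn => // Pi; rewrite integD ?IH//; first exact: LF.
exact: L1_sum.
Qed.

Lemma L1_bounded_mul f g : measurable_fun setT (g \o @vec R n) ->
  (forall x, `|g x| <= 1) -> L1 f -> L1 (fun x => f x * g x).
Proof.
move=> mg g1 Lf.
have /integrableP[mf _] := Lf.
have mf' : measurable_fun setT (f \o @vec R n) by apply/measurable_EFinP.
apply: le_integrable Lf => //.
  by apply/measurable_EFinP; exact: measurable_funM.
by move=> x _; rewrite !abse_EFin lee_fin normrM ler_piMr.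
Qed.

Lemma measurable_dotv xi :
  measurable_fun setT (fun x : ls_T (lspace R n) => dotv xi (vec x) : R).
Proof.
apply: measurable_sum => i; apply: measurable_funM => //.
exact: measurable_coord.
Qed.

(** [fcos] and [fsin] are the real part and minus the imaginary part of [fourier], so that all
    analysis is done with real integrals. *)
Definition fcos f xi := integ (fun x => f x * cos (2 * pi * dotv xi x)).
Definition fsin f xi := integ (fun x => f x * sin (2 * pi * dotv xi x)).

Lemma L1_cos f a xi : L1 f -> L1 (fun x => f x * cos (a * dotv xi x)).
Proof.
move=> Lf; apply: (L1_bounded_mul (g := fun x => cos (a * dotv xi x))) => //.
  apply: (measurableT_comp (f := @cos R)).
    by apply: continuous_measurable_fun; exact: continuous_cos.
  by apply: measurable_funM => //; exact: measurable_dotv.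
by move=> x; exact: cos_max.
Qed.

Lemma L1_sin f a xi : L1 f -> L1 (fun x => f x * sin (a * dotv xi x)).
Proof.
move=> Lf; apply: (L1_bounded_mul (g := fun x => sin (a * dotv xi x))) => //.
  apply: (measurableT_comp (f := @sin R)).
    by apply: continuous_measurable_fun; exact: continuous_sin.
  by apply: measurable_funM => //; exact: measurable_dotv.
by move=> x; exact: sin_max.
Qed.

Lemma fcosDZ f g k xi : L1 f -> L1 g ->
  fcos (fun x => f x + k * g x) xi = fcos f xi + k * fcos g xi.
Proof.
move=> Lf Lg; rewrite /fcos -integZ; last exact: L1_cos.
rewrite -integD; [|exact: L1_cos|by apply: L1Z; exact: L1_cos].
by congr integ; apply/funext => x; rewrite mulrDl mulrA.
Qed.

Lemma L1_affine f l c : l != 0 -> L1 f -> L1 (fun x => f (l *: x + c)).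
Proof.
move=> l0 Lf; have := scales_integrable (affine_scales c l0) Lf.
by apply: eq_integrable => // x _; rewrite /= vec_affine.
Qed.

Lemma integ_affine f l c : l != 0 -> L1 f ->
  integ (fun x => f (l *: x + c)) = `|l| ^- n.+1 * integ f.
Proof.
move=> l0 Lf; rewrite /integ -(scales_Rintegral (affine_scales c l0) Lf).
by apply: eq_Rintegral => // x _; rewrite /= vec_affine.
Qed.

Lemma dotvZl (m : nat) a (x y : 'rV[R]_m) : dotv (a *: x) y = a * dotv x y :> R.
Proof. by rewrite /dotv mulr_sumr; apply: eq_bigr => i _; rewrite mxE mulrA. Qed.

Lemma dotvZr (m : nat) a (x y : 'rV[R]_m) : dotv x (a *: y) = a * dotv x y :> R.
Proof. by rewrite /dotv mulr_sumr; apply: eq_bigr => i _; rewrite mxE mulrCA. Qed.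

Lemma dotvDr (m : nat) (x y z : 'rV[R]_m) : dotv x (y + z) = dotv x y + dotv x z :> R.
Proof. by rewrite /dotv -big_split; apply: eq_bigr => i _; rewrite mxE mulrDr. Qed.

Lemma dotvNr (m : nat) (x y : 'rV[R]_m) : dotv x (- y) = - dotv x y :> R.
Proof. by rewrite -scaleN1r dotvZr mulN1r. Qed.

Lemma fcos_scale f l xi : l != 0 -> L1 f ->
  fcos (fun x => f (l *: x)) xi = `|l| ^- n.+1 * fcos f (l^-1 *: xi).
Proof.
move=> l0 Lf; rewrite /fcos -(integ_affine 0 l0); last exact: L1_cos.
by congr integ; apply/funext => x; rewrite addr0 dotvZl dotvZr mulKf.
Qed.

Lemma fsin_scale f l xi : l != 0 -> L1 f ->
  fsin (fun x => f (l *: x)) xi = `|l| ^- n.+1 * fsin f (l^-1 *: xi).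
Proof.
move=> l0 Lf; rewrite /fsin -(integ_affine 0 l0); last exact: L1_sin.
by congr integ; apply/funext => x; rewrite addr0 dotvZl dotvZr mulKf.
Qed.

(** Substitute [x + c] for [x] and expand the cosine of a sum. *)
Lemma fcos_translate f c xi : L1 f ->
  fcos (fun x => f (x - c)) xi =
  fcos f xi * cos (2 * pi * dotv xi c) - fsin f xi * sin (2 * pi * dotv xi c).
Proof.
move=> Lf.
have -> : fcos (fun x => f (x - c)) xi =
    integ (fun x => f x * cos (2 * pi * dotv xi (x + c))).
  have L : L1 (fun x => f x * cos (2 * pi * dotv xi (x + c))).
    apply: (L1_bounded_mul (g := fun x => cos (2 * pi * dotv xi (x + c)))) => //.
      apply: (measurableT_comp (f := @cos R)).
        by apply: continuous_measurable_fun; exact: continuous_cos.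
      apply: measurable_funM => //; under eq_fun do rewrite dotvDr.
      by apply: measurable_funD => //; exact: measurable_dotv.
    by move=> x; exact: cos_max.
  have := integ_affine (- c) (oner_neq0 R) L.
  rewrite normr1 expr1n invr1 mul1r => <-.
  by congr integ; apply/funext => x; rewrite scale1r subrK.
transitivity (cos (2 * pi * dotv xi c) * fcos f xi +
  - sin (2 * pi * dotv xi c) * fsin f xi); last by ring.
rewrite /fcos /fsin -(integZ (cos _) (L1_cos (2 * pi) xi Lf)).
rewrite -(integZ (- sin _) (L1_sin (2 * pi) xi Lf)).
rewrite -integD; [|by apply: L1Z; exact: L1_cos|by apply: L1Z; exact: L1_sin].
by congr integ; apply/funext => x; rewrite dotvDr mulrDr cosD; ring.
Qed.

(** The substitution of [- x] for [x] turns the integral into its own opposite. *)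
Lemma fsin_even f xi : (forall x, f (- x) = f x) -> L1 f -> fsin f xi = 0.
Proof.
move=> fe Lf.
have N1 : -1 != 0 :> R by rewrite oppr_eq0 oner_neq0.
have := integ_affine 0 N1 (L1_sin (2 * pi) xi Lf).
have -> : (fun x => f (-1 *: x + 0) * sin (2 * pi * dotv xi (-1 *: x + 0))) =
   (fun x => -1 * (f x * sin (2 * pi * dotv xi x))).
  by apply/funext => x; rewrite addr0 scaleN1r fe dotvNr mulrN sinN; ring.
rewrite integZ; last exact: L1_sin.
rewrite normrN1 expr1n invr1 -/(fsin f xi) => h; lra.
Qed.
End L1_theory.

(** * Product functions and their transforms *)

Definition tensor {R : realType} {n : nat} (u : R -> R) (x : 'rV[R]_n.+1) : R :=
  \prod_(i < n.+1) u (x ord0 i).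

Lemma tensorS {R : realType} n (u : R -> R) (p : ls_T (lspace R n.+1)) :
  tensor u (vec p) = u p.1 * tensor u (vec p.2).
Proof.
rewrite /tensor big_ord_recl vecS0; congr (_ * _).
by apply: eq_bigr => i _; rewrite vecSl.
Qed.

Lemma dotvS {R : realType} n (xi : 'rV[R]_n.+2) (p : ls_T (lspace R n.+1)) :
  dotv xi (vec p) = xi ord0 ord0 * p.1 +
    dotv (\row_j xi ord0 (lift ord0 j) : 'rV[R]_n.+1) (vec p.2).
Proof.
rewrite {1}/dotv big_ord_recl vecS0; congr (_ + _).
by apply: eq_bigr => i _; rewrite vecSl mxE.
Qed.

Lemma L1_tensor {R : realType} n (u : R -> R) :
  (@lebesgue_measure R).-integrable setT (EFin \o u) ->
  L1 (@tensor R n u).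
Proof.
move=> iu; elim: n => [|n IH].
  apply: eq_integrable iu => // x _.
  by rewrite /= /tensor big_ord1 mxE.
have := @prod_integrable _ _ (measurableTypeR R) (ls_T (lspace R n)) R
  lebesgue_measure (ls_mu (lspace R n)) u (tensor u \o @vec R n) iu IH.
by apply: eq_integrable => // p _; rewrite tensorS.
Qed.

Lemma integrable1D_cos {R : realType} (u : R -> R) a :
  (@lebesgue_measure R).-integrable setT (EFin \o u) ->
  (@lebesgue_measure R).-integrable setT (EFin \o (fun x => u x * cos (a * x))).
Proof.
move=> iu.
have mu : measurable_fun setT u by apply/measurable_EFinP; exact: (measurable_int _ iu).
apply: le_integrable iu => //; last first.
  by move=> x _; rewrite !abse_EFin lee_fin normrM ler_piMr// cos_max.
apply/measurable_EFinP; apply: measurable_funM => //.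
apply: (measurableT_comp (f := @cos R)).
  by apply: continuous_measurable_fun; exact: continuous_cos.
exact: measurable_funM.
Qed.

Lemma integrable1D_sin {R : realType} (u : R -> R) a :
  (@lebesgue_measure R).-integrable setT (EFin \o u) ->
  (@lebesgue_measure R).-integrable setT (EFin \o (fun x => u x * sin (a * x))).
Proof.
move=> iu.
have mu : measurable_fun setT u by apply/measurable_EFinP; exact: (measurable_int _ iu).
apply: le_integrable iu => //; last first.
  by move=> x _; rewrite !abse_EFin lee_fin normrM ler_piMr// sin_max.
apply/measurable_EFinP; apply: measurable_funM => //.
apply: (measurableT_comp (f := @sin R)).
  by apply: continuous_measurable_fun; exact: continuous_sin.
exact: measurable_funM.
Qed.

Lemma Rintegral_even_sin {R : realType} (u : R -> R) a :
  (@lebesgue_measure R).-integrable setT (EFin \o u) -> (forall x, u (- x) = u x) ->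
  Rintegral (@lebesgue_measure R) setT (fun x => u x * sin (a * x)) = 0.
Proof.
move=> iu ue.
have N1 : -1 != 0 :> R by rewrite oppr_eq0 oner_neq0.
have isn := integrable1D_sin a iu.
have := scales_Rintegral (lebesgue_scales 0 N1) isn.
rewrite (_ : _ \o _ = fun x => -1 * (u x * sin (a * x))).
  rewrite RintegralZl// normrN1 invr1 => h; lra.
apply/funext => x /=; have -> : -1 * x + 0 = - x by ring.
by rewrite ue mulrN sinN; ring.
Qed.

(** Induction on the dimension: the addition formulas split the integrand into products of a
    function of the first coordinate and one of the others. Every product containing a sine factor
    integrates to 0 because [u] is even. *)
Lemma fourier_tensor {R : realType} n (u v : R -> R) (xi : 'rV[R]_n.+1) :
  (@lebesgue_measure R).-integrable setT (EFin \o u) ->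
  (forall x, u (- x) = u x) ->
  (forall t, Rintegral (@lebesgue_measure R) setT (fun x => u x * cos (2 * pi * t * x)) = v t) ->
  fcos (tensor u) xi = tensor v xi /\ fsin (tensor u) xi = 0.
Proof.
move=> iu ue uv; elim: n xi => [|n IH] xi.
  rewrite /tensor big_ord1 -uv; split.
    rewrite /fcos /integ; apply: eq_Rintegral => x _ /=.
    by rewrite /dotv !big_ord1 mxE mulrA.
  rewrite -(Rintegral_even_sin (2 * pi * xi ord0 ord0) iu ue).
  rewrite /fsin /integ; apply: eq_Rintegral => x _ /=.
  by rewrite /dotv !big_ord1 mxE mulrA.
pose xi' : 'rV[R]_n.+1 := \row_j xi ord0 (lift ord0 j).
have [IH1 IH2] := IH xi'.
pose c1 := fun x : measurableTypeR R => u x * cos (2 * pi * xi ord0 ord0 * x).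
pose s1 := fun x : measurableTypeR R => u x * sin (2 * pi * xi ord0 ord0 * x).
pose c2 := fun x : ls_T (lspace R n) => tensor u (vec x) * cos (2 * pi * dotv xi' (vec x)).
pose s2 := fun x : ls_T (lspace R n) => tensor u (vec x) * sin (2 * pi * dotv xi' (vec x)).
have ic1 : (@lebesgue_measure R).-integrable setT (EFin \o c1) by exact: integrable1D_cos.
have is1 : (@lebesgue_measure R).-integrable setT (EFin \o s1) by exact: integrable1D_sin.
have ic2 : (ls_mu (lspace R n)).-integrable setT (EFin \o c2).
  exact: (L1_cos (2 * pi) xi' (L1_tensor n iu)).
have is2 : (ls_mu (lspace R n)).-integrable setT (EFin \o s2).
  exact: (L1_sin (2 * pi) xi' (L1_tensor n iu)).
have s10 : Rintegral (@lebesgue_measure R) setT s1 = 0 by exact: Rintegral_even_sin.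
have s20 : Rintegral (ls_mu (lspace R n)) setT s2 = 0 by exact: IH2.
have c2E : Rintegral (ls_mu (lspace R n)) setT c2 = tensor v xi' by exact: IH1.
have icc := prod_integrable ic1 ic2.
have iss := prod_integrable is1 is2.
have ics := prod_integrable ic1 is2.
have isc := prod_integrable is1 ic2.
split.
- transitivity (Rintegral (pmeas lebesgue_measure (ls_mu (lspace R n))) setT
      (fun p => c1 p.1 * c2 p.2 - s1 p.1 * s2 p.2)).
    rewrite /fcos /integ; apply: eq_Rintegral => p _.
    rewrite tensorS dotvS -/xi' mulrDr cosD /c1 /c2 /s1 /s2 [2 * pi * (_ * _)]mulrA; ring.
  rewrite RintegralB//.
  rewrite (prod_Rintegral ic1 ic2) (prod_Rintegral is1 is2) s10 mul0r subr0 c2E.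
  rewrite /tensor [in RHS]big_ord_recl; congr (_ * _); first exact: uv.
  by apply: eq_bigr => i _; rewrite mxE.
- transitivity (Rintegral (pmeas lebesgue_measure (ls_mu (lspace R n))) setT
      (fun p => c1 p.1 * s2 p.2 + s1 p.1 * c2 p.2)).
    rewrite /fsin /integ; apply: eq_Rintegral => p _.
    rewrite tensorS dotvS -/xi' mulrDr sinD /c1 /c2 /s1 /s2 [2 * pi * (_ * _)]mulrA; ring.
  rewrite RintegralD//.
  by rewrite (prod_Rintegral ic1 is2) (prod_Rintegral is1 ic2) s10 s20 mul0r mulr0 addr0.
Qed.

(** * Continuity of cosine transforms, by way of sequences *)

Lemma seq_continuous {R : realType} {V : pseudoMetricType R} (F : V -> R) :
  (forall (x : V) (w : nat -> V), w k @[k --> \oo] --> x -> F (w k) @[k --> \oo] --> F x) ->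
  continuous F.
Proof.
move=> h x; apply/cvgrPdist_lt => e e0.
apply: contrapT => hn.
have /choice[w wP] : forall k : nat, exists y, ball x k.+1%:R^-1 y /\ ~ `|F x - F y| < e.
  move=> k; apply: contrapT => hk; apply: hn.
  apply/nbhs_ballP; exists k.+1%:R^-1 => /=; first by rewrite invr_gt0.
  move=> y xy; apply: contrapT => xy'; apply: hk.
  by exists y; split.
have wx : w k @[k --> \oo] --> x.
  apply/cvg_ballP => d d0.
  have := near_infty_natSinv_lt (PosNum d0); apply: filterS => k /= kd.
  by have [+ _] := wP k; apply: le_ball; exact: ltW.
have /cvgrPdist_lt/(_ e e0)[N _ hN] := h x w wx.
by have [_ +] := wP N; apply; exact: (hN N (leqnn N)).
Qed.

Lemma continuous_sum {R : realType} {T : topologicalType} (I : Type) (s : seq I)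
    (P : pred I) (F : I -> T -> R) :
  (forall i, P i -> continuous (F i)) ->
  continuous (fun x => \sum_(i <- s | P i) F i x).
Proof.
move=> cF; elim: s => [|i s IH].
  rewrite (_ : (fun _ => _) = cst 0); first exact: cst_continuous.
  by apply/funext => x; rewrite big_nil.
rewrite (_ : (fun _ => _) = (fun x => if P i then F i x + \sum_(j <- s | P j) F j x
    else \sum_(j <- s | P j) F j x)).
  case: (boolP (P i)) => // Pi x.
  by apply: cvgD; [exact: cF|exact: IH].
by apply/funext => x; rewrite big_cons.
Qed.

Lemma continuous_dotv {R : realType} {n : nat} (x : 'rV[R]_n.+1) :
  continuous (fun xi : 'rV[R]_n.+1 => dotv xi x).
Proof.
move=> xi; rewrite /dotv.
apply: continuous_sum => i _ y.
apply: (@continuousM R _ (fun z : 'rV[R]_n.+1 => z ord0 i) (fun=> x ord0 i) y).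
  exact: coord_continuous.
exact: cst_continuous.
Qed.

(** Dominated convergence along a sequence of frequencies, with dominating function [|f|]. *)
Lemma continuous_fcos {R : realType} {n : nat} (f : 'rV[R]_n.+1 -> R) :
  L1 f -> continuous (fcos f).
Proof.
move=> Lf; apply: seq_continuous => x w wx.
rewrite /fcos /integ /Rintegral.
apply: fine_cvg.
rewrite fineK; last by apply: integrable_fin_num => //; exact: (L1_cos (2 * pi) x Lf).
have Lab : L1 (fun x => `|f x|) by exact: integrable_norm Lf.
apply: (@dominated_cvg _ _ _ (ls_mu (lspace R n)) _ _
  (fun k y => (f (vec y) * cos (2 * pi * dotv (w k) (vec y)))%:E) _
  (fun y => `|f (vec y)|%:E)) => //.
- by move=> k; exact: measurable_int (L1_cos (2 * pi) (w k) Lf).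
- move=> y _; apply: cvg_EFin; first exact: nearW.
  apply: cvgMr.
  apply: (cvg_comp _ (@cos R)); last exact: continuous_cos.
  apply: cvgMr.
  by apply: (cvg_comp _ (fun z => dotv z (vec y)) wx); exact: continuous_dotv.
- by move=> k y _; rewrite abse_EFin lee_fin normrM ler_piMr// cos_max.
Qed.

(** * The pair tent / sinc^2 *)

Definition tent {R : realType} (d x : R) : R := Num.max 0 (1 - `|x| / d).

Lemma tent_ge0 {R : realType} (d x : R) : 0 <= tent d x.
Proof. by rewrite /tent le_max lexx. Qed.

Lemma tentN {R : realType} (d x : R) : tent d (- x) = tent d x.
Proof. by rewrite /tent normrN. Qed.

Lemma tent0 {R : realType} (d : R) : tent d 0 = 1.
Proof. by rewrite /tent normr0 mul0r subr0; apply/max_idPr. Qed.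

Lemma tent_out {R : realType} (d x : R) : 0 < d -> d <= `|x| -> tent d x = 0.
Proof.
by move=> d0 dx; apply/max_idPl; rewrite subr_le0 ler_pdivlMr// mul1r.
Qed.

Lemma tent_in {R : realType} (d x : R) : 0 < d -> `|x| <= d -> tent d x = 1 - `|x| / d.
Proof.
by move=> d0 dx; apply/max_idPr; rewrite subr_ge0 ler_pdivrMr// mul1r.
Qed.

Lemma tent_le1 {R : realType} (d x : R) : 0 < d -> tent d x <= 1.
Proof.
by move=> d0; rewrite /tent ge_max ler01 gerBl divr_ge0// ltW.
Qed.

(** The tent is a second difference of the absolute value; inverting [sinc2] produces it in this
    shape, since the integrals there are multiples of absolute values. *)
Lemma tentE {R : realType} (d x : R) : 0 < d ->
  tent d x = (`|d + x| + `|d - x| - 2 * `|x|) / (2 * d).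
Proof.
move=> d0.
have d0' : d != 0 by rewrite gt_eqF.
have h y : 0 <= y -> tent d y = (`|d + y| + `|d - y| - 2 * `|y|) / (2 * d).
  move=> y0; have [yd|dy] := leP y d.
    rewrite tent_in ?ger0_norm ?subr_ge0 ?addr_ge0 ?(ltW d0)//.
    by field.
  rewrite tent_out ?(ger0_norm y0) ?(ltW dy)//.
  rewrite ger0_norm ?addr_ge0 ?(ltW d0)// ler0_norm ?subr_le0 ?(ltW dy)//.
  by field.
have [x0|x0] := leP 0 x.
  by rewrite h.
by rewrite -tentN h ?oppr_ge0 ?ltW// opprK normrN [`|d - x| + _]addrC.
Qed.

Lemma continuous_tent {R : realType} (d : R) : continuous (tent d).
Proof.
have h : continuous (fun x : R => 1 - `|x| / d).
  move=> x; apply: cvgB; first exact: cvg_cst.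
  by apply: cvgMl; exact: norm_continuous.
move=> x; apply: (@continuous_max R R (cst 0) (fun x => 1 - `|x| / d)).
  exact: cst_continuous.
exact: h.
Qed.

Lemma Rintegral_FTC {R : realType} (F f : R -> R) (a b : R) : a < b ->
  continuous f -> (forall x : R, is_derive x 1 F (f x)) ->
  Rintegral (@lebesgue_measure R) `[a, b] f = F b - F a.
Proof.
move=> ab cf dF.
have cF : continuous F.
  move=> x; apply: differentiable_continuous; apply/derivable1_diffP.
  by have := dF x; move=> [].
rewrite /Rintegral (@continuous_FTC2 R f F)//.
- exact: continuous_subspaceT.
- split => [x _||].
  + by have := dF x; move=> [].
  + by apply: cvg_at_right_filter; exact: cF.
  + by apply: cvg_at_left_filter; exact: cF.
- by move=> x _; rewrite derive1E; have := dF x; move=> [].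
Qed.

Lemma tent_mul_integrable {R : realType} (d : R) (g : R -> R) : 0 < d ->
  continuous g ->
  (@lebesgue_measure R).-integrable setT (EFin \o (fun x => tent d x * g x)).
Proof.
move=> d0 cg.
have ct : continuous (fun x : R => tent d x * g x).
  by move=> x; apply: cvgM; [exact: continuous_tent|exact: cg].
have iK : (@lebesgue_measure R).-integrable `[-d, d] (EFin \o (fun x => tent d x * g x)).
  apply: continuous_compact_integrable; first exact: segment_compact.
  exact: continuous_subspaceT.
have mI : measurable (`[-d, d]%classic : set (measurableTypeR R)) by exact: measurable_itv.
have := (integrable_mkcond (EFin \o (fun x : measurableTypeR R => tent d x * g x)) mI).1 iK.
apply: eq_integrable => // x _; rewrite /= patchE; case: ifPn => // /negP.
rewrite inE /= in_itv/= -ler_norml => /negP; rewrite -ltNge => /ltW dx.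
by rewrite tent_out ?mul0r.
Qed.

(** Splitting at 0 leaves an affine weight on each side, so explicit primitives apply. *)
Lemma Rintegral_tent_mul {R : realType} (d : R) (g : R -> R) : 0 < d ->
  continuous g ->
  Rintegral (@lebesgue_measure R) setT (fun x => tent d x * g x) =
  Rintegral (@lebesgue_measure R) `[-d, 0] (fun x => (1 + x / d) * g x) +
  Rintegral (@lebesgue_measure R) `[0, d] (fun x => (1 - x / d) * g x).
Proof.
move=> d0 cg.
have it := tent_mul_integrable d0 cg.
have mI (i : interval R) : measurable ([set` i] : set (measurableTypeR R)) by exact: measurable_itv.
have iK (i : interval R) : (@lebesgue_measure R).-integrable [set` i]
    (EFin \o (fun x => tent d x * g x)).
  exact: integrableS it.
transitivity (Rintegral (@lebesgue_measure R) `[-d, d] (fun x => tent d x * g x)).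
  rewrite [RHS]Rintegral_mkcond; apply: eq_Rintegral => x _.
  rewrite patchE; case: ifPn => // /negP.
  rewrite inE /= in_itv/= -ler_norml => /negP; rewrite -ltNge => /ltW dx.
  by rewrite tent_out ?mul0r.
have b1 : (BLeft (- d) <= BRight 0 :> itv_bound R)%O by rewrite bnd_simp oppr_le0 ltW.
have b2 : (BRight 0 <= BRight d :> itv_bound R)%O by rewrite bnd_simp ltW.
have /eqP := @Rintegral_itvB R (fun x => tent d x * g x) (BLeft (-d)) (BRight d) 0 (iK _) b1 b2.
rewrite subr_eq => /eqP ->; rewrite addrC; congr (_ + _).
  apply: eq_Rintegral => x; rewrite inE/= in_itv/= => /andP[x1 x2].
  by rewrite tent_in ?ler0_norm// ?mulNr ?opprK// lerNl.
rewrite Rintegral_itv_obnd_cbnd//.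
apply: eq_Rintegral => x; rewrite inE/= in_itv/= => /andP[x1 x2].
by rewrite tent_in ?ger0_norm.
Qed.

(** This is [d] times the square of [sin (pi * d * x) / (pi * d * x)], written through [1 - cos] by
    the half-angle formula; the value [d] at 0 is its limit. *)
Definition sinc2 {R : realType} (d x : R) : R :=
  if x == 0 then d else (1 - cos (2 * pi * d * x)) / (2 * pi ^+ 2 * d * x ^+ 2).

Lemma tent_cos_neq0 {R : realType} (d a : R) : 0 < d -> a != 0 ->
  Rintegral (@lebesgue_measure R) setT (fun x => tent d x * cos (a * x)) =
  2 * (1 - cos (a * d)) / (d * a ^+ 2).
Proof.
move=> d0 a0; have d0' : d != 0 by rewrite gt_eqF.
have cg : continuous (fun x : R => cos (a * x)).
  move=> x; apply: (cvg_comp _ (@cos R)); last exact: continuous_cos.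
  by apply: cvgMr; exact: cvg_id.
rewrite Rintegral_tent_mul//.
(* Primitives on the two sides of 0, found by integration by parts. *)
pose F1 x := (1 + x / d) * sin (a * x) / a + cos (a * x) / (d * a ^+ 2).
pose F2 x := (1 - x / d) * sin (a * x) / a - cos (a * x) / (d * a ^+ 2).
have dF1 (x : R) : is_derive x 1 F1 ((1 + x / d) * cos (a * x)).
  by apply: is_derive_eq; rewrite /GRing.scale/=; field; rewrite ?a0 ?d0'.
have dF2 (x : R) : is_derive x 1 F2 ((1 - x / d) * cos (a * x)).
  by apply: is_derive_eq; rewrite /GRing.scale/=; field; rewrite ?a0 ?d0'.
have c1 : continuous (fun x : R => (1 + x / d) * cos (a * x)).
  move=> x; apply: cvgM; last exact: cg.
  by apply: cvgD; [exact: cvg_cst|apply: cvgMl; exact: cvg_id].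
have c2 : continuous (fun x : R => (1 - x / d) * cos (a * x)).
  move=> x; apply: cvgM; last exact: cg.
  by apply: cvgB; [exact: cvg_cst|apply: cvgMl; exact: cvg_id].
have Nd : - d < 0 by rewrite oppr_lt0.
rewrite (Rintegral_FTC Nd c1 dF1) (Rintegral_FTC d0 c2 dF2) /F1 /F2.
rewrite !mulr0 !mulrN cosN sin0 cos0 mulNr divff//.
by field; rewrite a0 d0'.
Qed.

Lemma tent_cos {R : realType} (d t : R) : 0 < d ->
  Rintegral (@lebesgue_measure R) setT (fun x => tent d x * cos (2 * pi * t * x)) =
  sinc2 d t.
Proof.
move=> d0; have d0' : d != 0 by rewrite gt_eqF.
have pi0 : pi != 0 :> R by rewrite gt_eqF// pi_gt0.
rewrite /sinc2; have [->|t0] := eqVneq t 0; last first.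
  rewrite tent_cos_neq0// ?mulf_neq0//.
  rewrite (mulrAC (2 * pi) t d).
  (* With [pi] and the cosine term replaced by variables, the identity is purely rational. *)
  have h (p C : R) : p != 0 -> 2 * C / (d * (2 * p * t) ^+ 2) = C / (2 * p ^+ 2 * d * t ^+ 2).
    by move=> p0; field; rewrite p0 t0 d0'.
  exact: h.
under eq_Rintegral do rewrite mulr0 mul0r cos0.
rewrite Rintegral_tent_mul//; last exact: cst_continuous.
pose F1 x := x + x ^+ 2 / (2 * d).
pose F2 x := x - x ^+ 2 / (2 * d).
have dF1 (x : R) : is_derive x 1 F1 ((1 + x / d) * 1).
  by apply: is_derive_eq; rewrite /GRing.scale/=; field; rewrite ?d0'.
have dF2 (x : R) : is_derive x 1 F2 ((1 - x / d) * 1).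
  by apply: is_derive_eq; rewrite /GRing.scale/=; field; rewrite ?d0'.
have c1 : continuous (fun x : R => (1 + x / d) * 1).
  move=> x; apply: cvgM; last exact: cvg_cst.
  by apply: cvgD; [exact: cvg_cst|apply: cvgMl; exact: cvg_id].
have c2 : continuous (fun x : R => (1 - x / d) * 1).
  move=> x; apply: cvgM; last exact: cvg_cst.
  by apply: cvgB; [exact: cvg_cst|apply: cvgMl; exact: cvg_id].
have Nd : - d < 0 by rewrite oppr_lt0.
rewrite (Rintegral_FTC Nd c1 dF1) (Rintegral_FTC d0 c2 dF2) /F1 /F2.
by field.
Qed.

(** * The integral of [(1 - cos t) / t ^+ 2] *)

Lemma integral_indicM {R : realType} (D : set (measurableTypeR R)) (k : R -> R) :
  (\int[@lebesgue_measure R]_x (\1_D x * k x)%:E =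
   \int[@lebesgue_measure R]_(x in D) (k x)%:E)%E.
Proof.
rewrite [RHS]integral_mkcond; apply: eq_integral => x _.
by rewrite patchE indicE; case: ifPn => _; rewrite ?mul1r ?mul0r.
Qed.

Lemma expRN_le_inv {R : realType} (u : R) : 0 < u -> expR (- u) <= u^-1.
Proof.
move=> u0; rewrite expRN lef_pV2 ?posrE ?expR_gt0//.
by have := expR_ge1Dx u; lra.
Qed.

Lemma expRN_le_inv2 {R : realType} (u : R) : 0 < u -> expR (- u) <= 2 * u ^- 2.
Proof.
move=> u0; have -> : 2 * u ^- 2 = (u ^+ 2 / 2)^-1.
  by field; rewrite gt_eqF.
have u2 : 0 < u ^+ 2 by rewrite exprn_gt0.
rewrite expRN lef_pV2 ?posrE ?expR_gt0 ?divr_gt0//.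
by have := expR_ge1Dxn 1 (ltW u0); rewrite (_ : 2`! = 2)%N//; lra.
Qed.

(** The decay test applied to the primitives of the two improper integrals below. *)
Lemma cvg0_le_inv {R : realType} (F : R -> R) (C : R) :
  (forall x, 1 <= x -> `|F x| <= C / x) -> F x @[x --> +oo%R] --> 0.
Proof.
move=> FC; apply/cvgrPdist_lt => e e0.
have C0 : 0 <= C by have := FC 1 (lexx _); rewrite divr1; apply: le_trans.
near=> x.
have x1 : 1 <= x by near: x; exact: nbhs_pinfty_ge.
have x0 : 0 < x by apply: lt_le_trans x1.
rewrite sub0r normrN; apply: (le_lt_trans (FC x x1)).
rewrite ltr_pdivrMr// mulrC -ltr_pdivrMr//.
by near: x; apply: nbhs_pinfty_gt; exact: num_real.
Unshelve. all: by end_near. Qed.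

(** This represents [t ^- 2] as a superposition of exponentials, which makes Tonelli applicable to
    [(1 - cos t) / t ^+ 2]. *)
Lemma integral_idM_expRN {R : realType} (t : R) : 0 < t ->
  (\int[@lebesgue_measure R]_(s in `]0%R, +oo[) (s * expR (- (s * t)))%:E = (t ^- 2)%:E)%E.
Proof.
move=> t0; have t0' : t != 0 by rewrite gt_eqF.
have cf : continuous (fun s : R => s * expR (- (s * t))).
  move=> x; apply: cvgM; first exact: cvg_id.
  apply: (cvg_comp _ (@expR R)); last exact: continuous_expR.
  by apply: cvgN; apply: cvgMl; exact: cvg_id.
rewrite integral_itv_obnd_cbnd; last first.
  by apply/measurable_EFinP; apply: measurable_funTS; exact: continuous_measurable_fun.
pose F s := - ((s / t + t ^- 2) * expR (- (s * t))).
have dF (x : R) : is_derive x 1 F (x * expR (- (x * t))).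
  by apply: is_derive_eq; rewrite /GRing.scale/=; field.
have cF : continuous F.
  move=> x; apply: differentiable_continuous; apply/derivable1_diffP.
  by have := dF x; move=> [].
rewrite (@ge0_continuous_FTC2y R (fun s => s * expR (- (s * t))) F 0 0)//.
- by rewrite -EFinB /F !mul0r oppr0 expR0; congr EFin; ring.
- by move=> x x0; rewrite mulr_ge0// expR_ge0.
- exact: continuous_subspaceT.
(* The quadratic bound on the exponential contributes 2 from the term [s / t], the linear bound
   contributes 1 from [t ^- 2]. *)
- apply: (@cvg0_le_inv _ _ (3 / t ^+ 3)) => x x1.
  have x0 : 0 < x by apply: lt_le_trans x1.
  have xt0 : 0 < x * t by rewrite mulr_gt0.
  have h1 := expRN_le_inv xt0; have h2 := expRN_le_inv2 xt0.
  have it0 : 0 <= x / t by rewrite divr_ge0 ?ltW.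
  have it2 : 0 <= t ^- 2 by rewrite invr_ge0 sqr_ge0.
  rewrite normrN ger0_norm; last by rewrite mulr_ge0 ?expR_ge0// addr_ge0.
  rewrite mulrDl; apply: (le_trans (lerD (ler_wpM2l it0 h2) (ler_wpM2l it2 h1))).
  by rewrite le_eqVlt; apply/orP; left; apply/eqP; field; rewrite t0' gt_eqF.
- by apply: cvg_at_right_filter; exact: cF.
- by move=> x _; rewrite derive1E; have := dF x; move=> [].
Qed.

Lemma integral_expRN_1Bcos {R : realType} (s : R) : 0 < s ->
  (\int[@lebesgue_measure R]_(t in `[0%R, +oo[) (expR (- (s * t)) * (1 - cos t))%:E =
   (s^-1 * (1 + s ^+ 2)^-1)%:E)%E.
Proof.
move=> s0; have s0' : s != 0 by rewrite gt_eqF.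
have s1 : 1 + s ^+ 2 != 0 by rewrite gt_eqF// ltr_wpDr// sqr_ge0.
have cf : continuous (fun t : R => expR (- (s * t)) * (1 - cos t)).
  move=> x; apply: cvgM.
    apply: (cvg_comp _ (@expR R)); last exact: continuous_expR.
    by apply: cvgN; apply: cvgMr; exact: cvg_id.
  by apply: cvgB; [exact: cvg_cst|exact: continuous_cos].
(* The first summand accounts for the constant 1 and the second for [- cos t]. *)
pose F t := expR (- (s * t)) * (- s^-1 + (1 + s ^+ 2)^-1 * (s * cos t - sin t)).
have dF (x : R) : is_derive x 1 F (expR (- (s * x)) * (1 - cos x)).
  by apply: is_derive_eq; rewrite /GRing.scale/=; field; rewrite s1 s0'.
have cF : continuous F.
  move=> x; apply: differentiable_continuous; apply/derivable1_diffP.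
  by have := dF x; move=> [].
rewrite (@ge0_continuous_FTC2y R (fun t => expR (- (s * t)) * (1 - cos t)) F 0 0)//.
- rewrite /F mulr0 oppr0 expR0 cos0 sin0 -EFinB; congr EFin.
  by field; rewrite s1 s0'.
- exact: continuous_subspaceT.
(* The numerator bounds the trigonometric factor of [F], and the exponential is at most
   [(s * x)^-1]. *)
- apply: (@cvg0_le_inv _ _ ((s^-1 + (1 + s ^+ 2)^-1 * (s + 1)) / s)) => x x1.
  have x0 : 0 < x by apply: lt_le_trans x1.
  have sx0 : 0 < s * x by rewrite mulr_gt0.
  have is1 : 0 <= (1 + s ^+ 2)^-1 by rewrite invr_ge0 addr_ge0// sqr_ge0.
  rewrite normrM (ger0_norm (expR_ge0 _)) mulrC.
  rewrite -[leRHS]mulrA -invfM; apply: ler_pM.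
  - exact: normr_ge0.
  - exact: expR_ge0.
  - apply: (le_trans (ler_normD _ _)); apply: lerD.
      by rewrite normrN ger0_norm// invr_ge0 ltW.
    rewrite normrM (ger0_norm is1); apply: ler_wpM2l => //.
    apply: (le_trans (ler_normB _ _)); apply: lerD; last exact: sin_max.
    by rewrite normrM gtr0_norm// ler_piMr ?cos_max// ltW.
  - exact: expRN_le_inv.
- by apply: cvg_at_right_filter; exact: cF.
- by move=> x _; rewrite derive1E; have := dF x; move=> [].
Qed.

(** Integrate [s * expR (- (s * t)) * (1 - cos t)] over the quadrant in both orders. Integrating
    over [s] first gives the left-hand integrand; integrating over [t] first gives
    [(1 + s ^+ 2)^-1], whose integral over the half-line is [pi / 2]. *)
Lemma integral0y_1Bcos {R : realType} :
  (\int[@lebesgue_measure R]_(t in `[0%R, +oo[) ((1 - cos t) / t ^+ 2)%:E = (pi / 2)%:E)%E.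
Proof.
(* [A] is the range of [t] and [B] that of [s]; [B] omits 0 because the inner integral over [t] is
   computed for [0 < s]. *)
pose A : set (measurableTypeR R) := `[0, +oo[%classic.
pose B : set (measurableTypeR R) := `]0, +oo[%classic.
have mA : measurable A by exact: measurable_itv.
have mB : measurable B by exact: measurable_itv.
pose h (p : measurableTypeR R * measurableTypeR R) : \bar R :=
  (\1_A p.1 * (\1_B p.2 * (p.2 * expR (- (p.2 * p.1)) * (1 - cos p.1))))%:E.
have mf1 : measurable_fun setT (fun p : measurableTypeR R * measurableTypeR R => p.1).
  exact: measurable_fst.
have mf2 : measurable_fun setT (fun p : measurableTypeR R * measurableTypeR R => p.2).
  exact: measurable_snd.
have mh : measurable_fun setT h.
  apply/measurable_EFinP; apply: measurable_funM.
    by apply: measurableT_comp => //; exact: measurable_indic.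
  apply: measurable_funM.
    by apply: measurableT_comp => //; exact: measurable_indic.
  apply: measurable_funM.
    apply: measurable_funM => //.
    apply: (measurableT_comp (f := @expR R)) => //.
    apply: measurableT_comp => //.
    exact: measurable_funM.
  apply: measurable_funB => //.
  apply: (measurableT_comp (f := @cos R)) => //.
  by apply: continuous_measurable_fun; exact: continuous_cos.
have h0 p : (0 <= h p)%E.
  rewrite lee_fin mulr_ge0 ?indic_ge0// {1}indicE.
  case: (boolP (p.2 \in B)) => pB; last by rewrite mul0r.
  rewrite mul1r mulr_ge0 ?subr_ge0 ?cos_le1// mulr_ge0 ?expR_ge0//.
  by move: pB; rewrite inE /B/= in_itv/= andbT => /ltW.
have := @fubini_tonelli _ _ _ _ R (@lebesgue_measure R) (@lebesgue_measure R) h mh h0.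
have -> : (\int[lebesgue_measure]_x \int[lebesgue_measure]_y h (x, y) =
   \int[@lebesgue_measure R]_(t in A) ((1 - cos t) / t ^+ 2)%:E)%E.
  rewrite -(integral_indicM A); apply: eq_integral => t _.
  rewrite indicE; case: (boolP (t \in A)) => tA; last first.
    rewrite mul0r; under eq_integral do rewrite /h/= indicE (negbTE tA) mul0r.
    by rewrite integral0.
  transitivity (\int[@lebesgue_measure R]_(s in B) (s * expR (- (s * t)) * (1 - cos t))%:E)%E.
    rewrite -(integral_indicM B); apply: eq_integral => s _.
    by rewrite /h/= [\1_A t]indicE tA mul1r.
  (* At [t = 0] both sides are 0, the quotient because its numerator vanishes and division by 0
     gives 0. *)
  have := tA; rewrite inE /A/= in_itv/= andbT le_eqVlt => /predU1P[<-|t0].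
    rewrite cos0 subrr mul0r mulr0.
    by under eq_integral do rewrite mulr0; rewrite integral0.
  under eq_integral do rewrite mulrC EFinM.
  rewrite ge0_integralZl//=.
  - by rewrite integral_idM_expRN// -EFinM mul1r.
  - apply/measurable_EFinP; apply: measurable_funTS; apply: continuous_measurable_fun.
    move=> x; apply: cvgM; first exact: cvg_id.
    apply: (cvg_comp _ (@expR R)); last exact: continuous_expR.
    by apply: cvgN; apply: cvgMl; exact: cvg_id.
  - by move=> s; rewrite /B/= in_itv/= andbT => s0; rewrite lee_fin mulr_ge0 ?expR_ge0// ltW.
move=> ->; rewrite -integral0y_oneDsqr -integral_itv_obnd_cbnd; last first.
  apply/measurable_EFinP; apply: measurable_funTS; apply: continuous_measurable_fun.
  exact: continuous_oneDsqrV.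
rewrite -/B -(integral_indicM B); apply: eq_integral => s _.
rewrite indicE; case: (boolP (s \in B)) => sB; last first.
  rewrite mul0r; under eq_integral do rewrite /h/= [\1_B s]indicE (negbTE sB) mul0r mulr0.
  by rewrite integral0.
have s0 : 0 < s by move: sB; rewrite inE /B/= in_itv/= andbT.
transitivity (\int[@lebesgue_measure R]_(t in A) (s * (expR (- (s * t)) * (1 - cos t)))%:E)%E.
  rewrite -(integral_indicM A); apply: eq_integral => t _.
  by rewrite /h/= [\1_B s]indicE sB mul1r !mulrA.
under eq_integral do rewrite EFinM.
rewrite ge0_integralZl//=.
- rewrite integral_expRN_1Bcos// -EFinM mulrA divff ?gt_eqF// !mul1r.
- apply/measurable_EFinP; apply: measurable_funTS; apply: continuous_measurable_fun.
  move=> x; apply: cvgM.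
    apply: (cvg_comp _ (@expR R)); last exact: continuous_expR.
    by apply: cvgN; apply: cvgMr; exact: cvg_id.
  by apply: cvgB; [exact: cvg_cst|exact: continuous_cos].
- by rewrite lee_fin ltW.
Qed.

(** Inversion is continuous off 0, and the single point 0 is a measurable set. *)
Lemma measurable_invr {R : realType} : measurable_fun setT (@GRing.inv R).
Proof.
rewrite -(setvU [set (0 : R)]); apply/measurable_funU => //.
  by apply: measurableC; exact: measurable_set1.
split; last exact: measurable_fun_set1.
apply: open_continuous_measurable_fun.
  by rewrite openC; exact: closed_eq.
by move=> x; rewrite inE /= => /eqP x0; exact: inv_continuous.
Qed.

(** For [b = 1], evenness doubles the half-line integral; the general case follows by substituting
    [b * t] for [t]. *)
Lemma integral_1Bcos {R : realType} (b : R) :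
  (\int[@lebesgue_measure R]_t ((1 - cos (b * t)) / t ^+ 2)%:E = (pi * `|b|)%:E)%E.
Proof.
pose q (t : measurableTypeR R) : R := (1 - cos t) / t ^+ 2.
pose A : set (measurableTypeR R) := `[0, +oo[%classic.
pose B : set (measurableTypeR R) := `]0, +oo[%classic.
have mA : measurable A by exact: measurable_itv.
have mB : measurable B by exact: measurable_itv.
have q0 t : 0 <= q t by rewrite mulr_ge0 ?invr_ge0 ?sqr_ge0// subr_ge0 cos_le1.
have mq : measurable_fun setT q.
  apply: measurable_funM.
    apply: measurable_funB => //.
    by apply: continuous_measurable_fun; exact: continuous_cos.
  apply: (measurableT_comp (f := @GRing.inv R)); last exact: exprn_measurable.
  exact: measurable_invr.
have mqE : measurable_fun setT (EFin \o q) by exact/measurable_EFinP.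
have N1 : -1 != 0 :> R by rewrite oppr_eq0 oner_neq0.
have piE : (\int[@lebesgue_measure R]_t (q t)%:E = (pi : R)%:E)%E.
  have half : (\int[@lebesgue_measure R]_t (\1_A t * q t)%:E = (pi / 2)%:E)%E.
    by rewrite (integral_indicM A) integral0y_1Bcos.
  have half' : (\int[@lebesgue_measure R]_t (\1_B t * q t)%:E = (pi / 2)%:E)%E.
    rewrite (integral_indicM B) integral_itv_obnd_cbnd ?integral0y_1Bcos//.
    exact: measurable_funTS.
  have mBq : measurable_fun setT (fun t => (\1_B t * q t)%:E).
    by apply/measurable_EFinP; apply: measurable_funM => //; exact: measurable_indic.
  have mAq : measurable_fun setT (fun t => (\1_A t * q t)%:E).
    by apply/measurable_EFinP; apply: measurable_funM => //; exact: measurable_indic.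
  have Bq0 t : (0 <= (\1_B t * q t)%:E)%E by rewrite lee_fin mulr_ge0.
  have Aq0 t : (0 <= (\1_A t * q t)%:E)%E by rewrite lee_fin mulr_ge0.
  have [mphi _ /(_ _ mBq Bq0)] := lebesgue_scales 0 N1.
  rewrite normrN1 invr1 mul1e half' => half2.
  (* The line is the disjoint union of [A] and the reflection of [B], so 0 is counted exactly
     once. *)
  transitivity (\int[@lebesgue_measure R]_t ((\1_A t * q t)%:E +
    (\1_B (-1 * t + 0) * q (-1 * t + 0))%:E))%E.
    apply: eq_integral => t _; rewrite -EFinD; congr EFin.
    have -> : -1 * t + 0 = - t by ring.
    have -> : q (- t) = q t by rewrite /q cosN sqrrN.
    rewrite -mulrDl !indicE.
    rewrite (_ : (t \in A) = (0 <= t)); last by apply/idP/idP; rewrite inE /A/= in_itv/= andbT.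
    rewrite (_ : (- t \in B) = (t < 0)); last first.
      by apply/idP/idP; rewrite inE /B/= in_itv/= andbT oppr_gt0.
    by case: leP => _; rewrite ?addr0 ?add0r mul1r.
  rewrite ge0_integralD//; last exact: (measurableT_comp mBq mphi).
  by rewrite half half2 -EFinD; congr EFin; field.
have [->|b0] := eqVneq b 0.
  rewrite normr0 mulr0; under eq_integral do rewrite mul0r cos0 subrr mul0r.
  by rewrite integral0.
have q0E t : (0 <= (EFin \o q) t)%E by rewrite lee_fin.
have [mphi _ /(_ _ mqE q0E)] := lebesgue_scales 0 b0.
rewrite piE => h.
(* The factor [b ^+ 2] comes from the denominator of the integrand, [|b|^-1] from the change of
   variable. *)
have -> : (pi * `|b|)%:E = ((b ^+ 2)%:E * (`|b|^-1%:E * (pi : R)%:E))%E.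
  rewrite -!EFinM; congr EFin; rewrite -(@real_normK _ b) ?num_real//.
  by field; rewrite normr_eq0.
rewrite -h -ge0_integralZl//.
- apply: eq_integral => t _ /=; rewrite -EFinM; congr EFin.
  rewrite addr0 /q; have [->|t0] := eqVneq t 0.
    by rewrite mulr0 cos0 subrr !mul0r mulr0.
  by field; rewrite t0 b0.
- exact: (measurableT_comp mqE mphi).
- by rewrite lee_fin sqr_ge0.
Qed.

Lemma sinc2_ge0 {R : realType} (d x : R) : 0 < d -> 0 <= sinc2 d x.
Proof.
move=> d0; rewrite /sinc2; case: ifP => _; first exact: ltW.
rewrite divr_ge0 ?subr_ge0 ?cos_le1//.
by rewrite mulr_ge0 ?sqr_ge0// mulr_ge0 ?(ltW d0)// mulr_ge0 ?sqr_ge0.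
Qed.

Lemma sinc2N {R : realType} (d x : R) : sinc2 d (- x) = sinc2 d x.
Proof. by rewrite /sinc2 oppr_eq0 mulrN cosN sqrrN. Qed.

Lemma sinc20 {R : realType} (d : R) : sinc2 d 0 = d.
Proof. by rewrite /sinc2 eqxx. Qed.

Lemma integrable_1Bcos {R : realType} (b : R) :
  (@lebesgue_measure R).-integrable setT (EFin \o (fun t => (1 - cos (b * t)) / t ^+ 2)).
Proof.
apply/integrableP; split.
  apply/measurable_EFinP; apply: measurable_funM.
    apply: measurable_funB => //.
    apply: (measurableT_comp (f := @cos R)); last exact: measurable_funM.
    by apply: continuous_measurable_fun; exact: continuous_cos.
  apply: (measurableT_comp (f := @GRing.inv R)); last exact: exprn_measurable.
  exact: measurable_invr.
under eq_integral => t _.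
  rewrite /= ger0_norm; last by rewrite mulr_ge0 ?invr_ge0 ?sqr_ge0// subr_ge0 cos_le1.
  over.
by rewrite integral_1Bcos ltry.
Qed.

Lemma Rintegral_1Bcos {R : realType} (b : R) :
  Rintegral (@lebesgue_measure R) setT (fun t => (1 - cos (b * t)) / t ^+ 2) = pi * `|b|.
Proof. by rewrite /Rintegral integral_1Bcos. Qed.

Lemma integrable_set0_indic {R : realType} (d : R) :
  (@lebesgue_measure R).-integrable setT (EFin \o (fun t => d * \1_[set 0] t)).
Proof.
have h : (@lebesgue_measure R).-integrable setT (EFin \o (\1_[set (0:R)] : R -> R)).
  apply/integrableP; split; first by apply/measurable_EFinP; exact: measurable_indic.
  under eq_integral => t _ do rewrite /= ger0_norm//.
  by rewrite integral_indic// setIT [X in (X < _)%E](@lebesgue_measure_set1 R 0) ltry.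
by apply: eq_integrable (integrableZl _ d h).
Qed.

Lemma Rintegral_set0_indic {R : realType} (d : R) :
  Rintegral (@lebesgue_measure R) setT (fun t => d * \1_[set 0] t) = 0.
Proof.
have h : (@lebesgue_measure R).-integrable setT (EFin \o (\1_[set (0:R)] : R -> R)).
  by have := integrable_set0_indic (1 : R); apply: eq_integrable => // t _; rewrite /= mul1r.
rewrite RintegralZl// /Rintegral integral_indic// setIT [X in fine X](@lebesgue_measure_set1 R 0).
by rewrite mulr0.
Qed.

(** Since division by 0 gives 0, the quotient alone vanishes at the origin; the value [d] is
    restored by the indicator of a null set, which integrals ignore. *)
Lemma sinc2E {R : realType} (d t : R) : 0 < d ->
  sinc2 d t = (2 * pi ^+ 2 * d)^-1 * ((1 - cos (2 * pi * d * t)) / t ^+ 2) + d * \1_[set 0] t.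
Proof.
move=> d0; rewrite /sinc2 indicE; have [->|t0] := eqVneq t 0.
  rewrite mulr0 cos0 subrr mul0r mulr0 add0r.
  by rewrite mem_set// mulr1.
rewrite memNset ?mulr0 ?addr0; last exact/eqP.
by rewrite invfM mulrA mulrAC [RHS]mulrC mulrA.
Qed.

Lemma integrable_sinc2 {R : realType} (d : R) : 0 < d ->
  (@lebesgue_measure R).-integrable setT (EFin \o sinc2 d).
Proof.
move=> d0.
have h1 := integrableZl measurableT (2 * pi ^+ 2 * d)^-1 (integrable_1Bcos (2 * pi * d)).
apply: eq_integrable (integrableD _ h1 (integrable_set0_indic d)) => //.
by move=> t _; rewrite /= sinc2E.
Qed.

(** The identity [2 (1 - cos A) cos B = (1 - cos (A + B)) + (1 - cos (A - B)) - 2 (1 - cos B)]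
    reduces the integral to three instances of [Rintegral_1Bcos], and [tentE] recognises the
    result. *)
Lemma sinc2_cos {R : realType} (d x : R) : 0 < d ->
  Rintegral (@lebesgue_measure R) setT (fun t => sinc2 d t * cos (2 * pi * x * t)) =
  tent d x.
Proof.
move=> d0; have d0' : d != 0 by rewrite gt_eqF.
have pi0 : 0 < pi :> R by rewrite pi_gt0.
pose k := (4 * pi ^+ 2 * d)^-1.
pose g b (t : measurableTypeR R) := (1 - cos (2 * pi * b * t)) / t ^+ 2.
have ig b : (@lebesgue_measure R).-integrable setT (EFin \o g b) by exact: integrable_1Bcos.
have igD b c : (@lebesgue_measure R).-integrable setT (EFin \o (fun t => g b t + g c t)).
  by apply: eq_integrable (integrableD _ (ig b) (ig c)).
have igZ c b : (@lebesgue_measure R).-integrable setT (EFin \o (fun t => c * g b t)).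
  by apply: eq_integrable (integrableZl _ c (ig b)).
have igB : (@lebesgue_measure R).-integrable setT
    (EFin \o (fun t => g (d + x) t + g (d - x) t - 2 * g x t)).
  by apply: eq_integrable (integrableB _ (igD _ _) (igZ _ _)).
have igk : (@lebesgue_measure R).-integrable setT
    (EFin \o (fun t => k * (g (d + x) t + g (d - x) t - 2 * g x t))).
  by apply: eq_integrable (integrableZl _ k igB).
transitivity (Rintegral (@lebesgue_measure R) setT (fun t =>
   k * (g (d + x) t + g (d - x) t - 2 * g x t) + d * \1_[set 0] t)).
  apply: eq_Rintegral => t _; rewrite sinc2E// indicE.
  have [->|t0] := eqVneq t 0.
    by rewrite mem_set// /g !mulr0 cos0 subrr !mul0r !mulr0 !addr0 subr0 mulr0 !add0r !mulr1.
  rewrite memNset ?mulr0 ?addr0; last exact/eqP.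
  have -> : g (d + x) t = (1 - cos (2 * pi * d * t + 2 * pi * x * t)) / t ^+ 2.
    by rewrite /g; congr ((1 - cos _) / _); ring.
  have -> : g (d - x) t = (1 - cos (2 * pi * d * t - 2 * pi * x * t)) / t ^+ 2.
    by rewrite /g; congr ((1 - cos _) / _); ring.
  rewrite /g /k cosD cosB; move: pi0; move: (pi : R) => p p0.
  by field; rewrite t0 d0' gt_eqF.
rewrite RintegralD//; last exact: integrable_set0_indic.
rewrite Rintegral_set0_indic addr0 RintegralZl//.
rewrite RintegralB// RintegralD// RintegralZl// !Rintegral_1Bcos.
have -> : `|2 * pi * (d + x)| = 2 * pi * `|d + x|.
  by rewrite normrM ger0_norm// mulr_ge0// ltW.
have -> : `|2 * pi * (d - x)| = 2 * pi * `|d - x|.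
  by rewrite normrM ger0_norm// mulr_ge0// ltW.
have -> : `|2 * pi * x| = 2 * pi * `|x|.
  by rewrite normrM ger0_norm// mulr_ge0// ltW.
rewrite tentE// /k; move: pi0; move: (pi : R) => p p0.
by field; rewrite d0' gt_eqF.
Qed.

(** * Admissible functions and rescaling *)

Lemma Re_fourier {R : realType} n (f : 'rV[R]_n.+1 -> R) xi :
  complex.Re (fourier f xi) = fcos f xi.
Proof. by rewrite /fourier /= /fcos; lra. Qed.

Lemma Im_fourier {R : realType} n (f : 'rV[R]_n.+1 -> R) xi :
  complex.Im (fourier f xi) = - fsin f xi.
Proof. by rewrite /fourier /= /fsin; lra. Qed.

Lemma fourierE {R : realType} n (f : 'rV[R]_n.+1 -> R) xi :
  fourier f xi = Complex (fcos f xi) (- fsin f xi).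
Proof. by rewrite -Re_fourier -Im_fourier; case: (fourier f xi). Qed.

(** In the order on [R[i]], being nonnegative includes being real. *)
Lemma fourier_ge0 {R : realType} n (f : 'rV[R]_n.+1 -> R) xi :
  (0 <= fourier f xi) = (fsin f xi == 0) && (0 <= fcos f xi).
Proof. by rewrite fourierE lecE /= oppr_eq0. Qed.

Lemma enormZ {R : realType} n (a : R) (x : 'rV[R]_n) : enorm (a *: x) = `|a| * enorm x.
Proof.
rewrite /enorm.
have -> : dotv (a *: x) (a *: x) = a ^+ 2 * dotv x x.
  by rewrite /dotv mulr_sumr; apply: eq_bigr => i _; rewrite !mxE; ring.
by rewrite sqrtrM ?sqr_ge0// sqrtr_sqr.
Qed.

Lemma enorm0 {R : realType} n : enorm (0 : 'rV[R]_n) = 0.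
Proof. by rewrite -(scale0r 0) enormZ normr0 mul0r. Qed.

Lemma enorm_ge0 {R : realType} n (x : 'rV[R]_n) : 0 <= enorm x.
Proof. exact: sqrtr_ge0. Qed.

Lemma enorm_delta {R : realType} n : enorm (delta_mx ord0 ord0 : 'rV[R]_n.+1) = 1.
Proof.
rewrite /enorm /dotv big_ord_recl big1 => [|i _]; last by rewrite !mxE /= mulr0.
by rewrite !mxE /= mulr1 addr0 sqrtr1.
Qed.

Lemma continuous_enorm {R : realType} n : continuous (@enorm R n.+1).
Proof.
have c : continuous (fun x : 'rV[R]_n.+1 => dotv x x).
  apply: continuous_sum => i _ y.
  apply: (@continuousM R _ (fun z : 'rV[R]_n.+1 => z ord0 i) (fun z : 'rV[R]_n.+1 => z ord0 i) y);
    exact: coord_continuous.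
move=> x; apply: (cvg_comp (fun x : 'rV[R]_n.+1 => dotv x x) (@Num.sqrt R)); first exact: c.
exact: sqrt_continuous.
Qed.

Lemma sign_radius_gt0 {R : realType} n (f : 'rV[R]_n.+1 -> R) r :
  0 < f 0 -> (forall x, r <= enorm x -> f x <= 0) -> 0 < r.
Proof.
move=> f0 fr; rewrite ltNge; apply/negP => r0.
by have := fr 0; rewrite enorm0 => /(_ r0); rewrite leNgt f0.
Qed.

(** Positivity at the origin makes 0 a lower bound of the admissible radii, so the infimum is a
    genuine one. *)
Lemma rf_le {R : realType} n (f : 'rV[R]_n.+1 -> R) r :
  0 < f 0 -> (forall x, r <= enorm x -> f x <= 0) -> rf f <= r.
Proof.
move=> f0 fr; apply: ge_inf => //.
by exists 0 => s /(sign_radius_gt0 f0) /ltW.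
Qed.

Lemma continuous_scale {R : realType} n (x : 'rV[R]_n.+1) : continuous (fun t : R => t *: x).
Proof. by move=> t; apply: cvgZr_tmp; exact: cvg_id. Qed.

(** By continuity [f] stays positive on a short segment from the origin, which rules out all small
    radii. *)
Lemma rf_gt0 {R : realType} n (f : 'rV[R]_n.+1 -> R) : inF f -> 0 < rf f.
Proof.
move=> [[cf _ _ _] _ f0 _ [r0 r00 fr0]].
pose e : 'rV[R]_n.+1 := delta_mx ord0 ord0.
have cfe : {for (0:R), continuous (fun t : R => f (t *: e))}.
  apply: (cvg_comp (fun t : R => t *: e) f); first exact: continuous_scale.
  exact: cf.
have : \forall t \near (0:R), 0 < f (t *: e).
  have := cvgr_gt _ cfe; apply.
  by rewrite scale0r.
move=> /nbhs_ballP[d /= d0 hd].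
apply: (@lt_le_trans _ _ (d / 2)); first by rewrite divr_gt0.
apply: lb_le_inf; first by exists r0.
move=> s fs; rewrite leNgt; apply/negP => sd.
have : f ((d / 2) *: e) <= 0.
  by apply: fs; rewrite enormZ enorm_delta mulr1 ger0_norm ?(ltW sd)// divr_ge0// ltW.
rewrite leNgt => /negP; apply; apply: hd.
rewrite /ball /= sub0r normrN ger0_norm ?divr_ge0 ?(ltW d0)//.
by rewrite ltr_pdivrMr// ltr_pMr// ltr1n.
Qed.

(** The infimum is attained. Strictly outside the sphere some admissible radius is small enough; on
    the sphere, a positive value would persist a little further along the ray through [x]. *)
Lemma le0_beyond_rf {R : realType} n (f : 'rV[R]_n.+1 -> R) x :
  inF f -> rf f <= enorm x -> f x <= 0.
Proof.
move=> Ff; have rf0 := rf_gt0 Ff; move: Ff => [[cf _ _ _] _ f0 _ [r0 r00 fr0]].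
have strict y : rf f < enorm y -> f y <= 0.
  move=> ry; have hi : has_inf [set r : R | forall x, r <= enorm x -> f x <= 0].
    by split; [exists r0|exists 0 => s /(sign_radius_gt0 f0) /ltW].
  have ry0 : 0 < enorm y - rf f by rewrite subr_gt0.
  have [s fs sy] := inf_adherent ry0 hi.
  by apply: fs; rewrite ltW// (lt_le_trans sy)// addrC subrK.
move=> rx; rewrite leNgt; apply/negP => fx.
have cfx : {for (1:R), continuous (fun t : R => f (t *: x))}.
  apply: (cvg_comp (fun t : R => t *: x) f); first exact: continuous_scale.
  exact: cf.
have : \forall t \near (1:R), 0 < f (t *: x).
  have := cvgr_gt _ cfx; apply.
  by rewrite scale1r.
move=> /nbhs_ballP[d /= d0 hd].
have : 0 < f ((1 + d / 2) *: x).
  apply: hd; rewrite /ball /= opprD addrA subrr sub0r normrN ger0_norm ?divr_ge0 ?(ltW d0)//.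
  by rewrite ltr_pdivrMr// ltr_pMr// ltr1n.
rewrite ltNge => /negP; apply; apply: strict.
rewrite enormZ ger0_norm; last by rewrite addr_ge0// divr_ge0// ltW.
apply: (le_lt_trans rx); rewrite mulrDl mul1r ltrDl mulr_gt0 ?divr_gt0//.
exact: lt_le_trans rx.
Qed.

Lemma L10 {R : realType} n : L1 (fun _ : 'rV[R]_n.+1 => 0).
Proof. exact: integrable0. Qed.

(** Slack in [g 0 < fcos g 0] is traded for radius: a contraction [h] of [g] restores equality at 0,
    belongs to the class [inF], and has sign radius strictly below [r]. *)
Lemma Rdim_lt {R : realType} n (g : 'rV[R]_n.+1 -> R) r :
  continuous g -> (forall x, g (- x) = g x) -> L1 g -> L1 (fcos g) ->
  (forall xi, 0 <= fcos g xi) -> 0 < g 0 -> g 0 < fcos g 0 ->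
  (forall x, r <= enorm x -> g x <= 0) -> Rdim R n < r.
Proof.
move=> cg ge Lg Lgh gh0 g0 g0h gr.
have r0 := sign_radius_gt0 g0 gr.
pose q := fcos g 0 / g 0.
have q1 : 1 < q by rewrite ltr_pdivlMr// mul1r.
have q0 : 0 < q by apply: lt_trans q1.
(* The root of [q] of order [n.+1]: scaling by [l] divides the transform at 0 by [l ^+ n.+1 = q] and
   leaves the value at 0 unchanged. *)
pose l := expR (ln q / n.+1%:R).
have l0 : 0 < l by exact: expR_gt0.
have l1 : 1 < l by rewrite expR_gt1 divr_gt0// ln_gt0.
have lq : l ^+ n.+1 = q by rewrite -expRM_natr divfK// lnK// posrE.
have l0' : l != 0 by rewrite gt_eqF.
pose h := fun x => g (l *: x).
have hS xi : fsin h xi = 0.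
  by rewrite fsin_scale// fsin_even// mulr0.
have hC xi : fcos h xi = q^-1 * fcos g (l^-1 *: xi).
  by rewrite fcos_scale// (gtr0_norm l0) lq.
have Fh : inF h.
  split.
  - split.
    + move=> x; apply: (cvg_comp (fun x => l *: x) g); last exact: cg.
      exact: scaler_continuous.
    + by move=> x; rewrite /h scalerN ge.
    + have := L1_affine 0 l0' Lg.
      by apply: eq_integrable => // x _; rewrite addr0.
    + split.
        have li0 : l^-1 != 0 by rewrite invr_eq0.
        have := L1Z q^-1 (L1_affine 0 li0 Lgh).
        by apply: eq_integrable => // x _; rewrite addr0 Re_fourier hC.
      have := @L10 R n.
      by apply: eq_integrable => // x _; rewrite Im_fourier hS oppr0.
  - rewrite fourierE hS hC scaler0 oppr0 /h scaler0 /q invfM invrK; congr Complex.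
    by field; rewrite !gt_eqF// (lt_trans g0).
  - by rewrite /h scaler0.
  - move=> xi; rewrite fourier_ge0 hS eqxx hC mulr_ge0//.
    by rewrite invr_ge0 ltW.
  - exists r => // x rx; apply: gr; rewrite enormZ gtr0_norm//.
    by apply: (le_trans rx); rewrite ler_peMl ?enorm_ge0// ltW.
have rfh : rf h <= r / l.
  apply: rf_le; first by rewrite /h scaler0.
  by move=> x rx; apply: gr; rewrite enormZ gtr0_norm// mulrC -ler_pdivrMr.
apply: (@le_lt_trans _ _ (rf h)).
  apply: ge_inf; last by exists h.
  by exists 0 => _ [u Fu <-]; rewrite ltW// rf_gt0.
by apply: (le_lt_trans rfh); rewrite ltr_pdivrMr// ltr_pMr.
Qed.

(** Continuity gives such an [e] around each point of [D], and compactness makes it uniform. One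
    number serves both as distance and as lower bound. *)
Lemma compact_gt0_thickening {R : realType} n (D : set 'rV[R]_n.+1) (psi : 'rV[R]_n.+1 -> R) :
  compact D -> continuous psi -> (forall z, D z -> 0 < psi z) ->
  exists2 e, 0 < e & forall z y, D z -> `|y - z| < e -> e <= psi y.
Proof.
move=> cD cpsi psi0.
pose P (e : R) (z : 'rV[R]_n.+1) := forall y, `|y - z| < e -> e <= psi y.
have := (compact_near_coveringP D).1 cD R (0^'+) P _.
move=> /(_ _)[].
  move=> z Dz.
  have : \forall y \near z, psi z / 2 < psi y.
    by apply: (cvgr_gt _ (cpsi z)); rewrite ltr_pdivrMr// ltr_pMr ?psi0// ltr1n.
  move=> /nbhs_ballP[d /= d0 hd].
  (* Half of the radius [d] is spent on moving the centre from [z] to [z'], the other half on moving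
     from [z'] to [y]. *)
  exists (ball z (d / 2), [set e | e < Num.min (d / 2) (psi z / 2)]).
    split => /=; first by apply: nbhsx_ballx; rewrite divr_gt0.
    by apply: nbhs_right_lt; rewrite lt_min !divr_gt0 ?psi0.
  move=> [z' e] /= [zz' ed] y ye; move: ed; rewrite lt_min => /andP[ed ep].
  apply: (le_trans (ltW ep)); apply/ltW/hd.
  rewrite -ball_normE /= in zz' *.
  rewrite -(subrKA z') (le_lt_trans (ler_normD _ _))// [d]splitr ltrD//.
  by rewrite distrC (lt_trans ye).
move=> e0 /= e00 he.
exists (e0 / 2); first by rewrite divr_gt0.
move=> z y Dz zy.
suff : D `<=` P (e0 / 2) by move=> /(_ z Dz y zy).
apply: he => /=; last by rewrite divr_gt0.
rewrite sub0r normrN ger0_norm ?divr_ge0 ?(ltW e00)//.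
by rewrite ltr_pdivrMr// ltr_pMr// ltr1n.
Qed.

Lemma compact_setdiffs {R : realType} n (S : set 'rV[R]_n.+1) :
  compact S -> compact (setdiffs S S).
Proof.
move=> cS.
have -> : setdiffs S S = (fun p : 'rV[R]_n.+1 * 'rV[R]_n.+1 => p.1 - p.2) @` (S `*` S).
  apply/seteqP; split => [z [a [b [Sa Sb ->]]]|z [[a b] [/= Sa Sb] <-]].
    by exists (a, b).
  by exists a, b.
apply: continuous_compact; last exact: compact_setX.
apply: continuous_subspaceT => p.
by apply: cvgB; [exact: cvg_fst|exact: cvg_snd].
Qed.

(** * Covering by a grid of cubes *)

(** The norm of a row vector in this notation is the maximum norm, as opposed to the Euclidean
    [enorm]. *)
Lemma rV_norm_coord_le {R : realType} n (x : 'rV[R]_n.+1) i : `|x ord0 i| <= `|x|.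
Proof.
rewrite [leRHS]mx_normrE.
exact: (le_bigmax 0 (fun ij : 'I_1 * 'I_n.+1 => `|x ij.1 ij.2|) (ord0, i)).
Qed.

Lemma rV_norm_le {R : realType} n (x : 'rV[R]_n.+1) e :
  0 <= e -> (forall i, `|x ord0 i| <= e) -> `|x| <= e.
Proof.
move=> e0 h; rewrite [leLHS]mx_normrE; apply: bigmax_le => // -[i j] _ /=.
by rewrite (ord1 i).
Qed.

Definition box {R : realType} {n : nat} (c : 'rV[R]_n.+1) (d : R) : set 'rV[R]_n.+1 :=
  [set x | forall i, c ord0 i <= x ord0 i < c ord0 i + d].

Lemma box_measure {R : realType} n (c : 'rV[R]_n.+1) (d : R) : 0 < d ->
  measurable (@vec R n @^-1` box c d) /\ leb (box c d) = (d ^+ n.+1)%:E.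
Proof.
move=> d0; elim: n c => [|n IH] c.
  have E : @vec R 0 @^-1` box c d = `[c ord0 ord0, c ord0 ord0 + d[%classic.
    apply/seteqP; split => x /=; rewrite in_itv/=.
      by move=> /(_ ord0); rewrite mxE.
    by move=> h i; rewrite mxE (ord1 i).
  split; first by rewrite E; exact: measurable_itv.
  rewrite /leb E; transitivity (lebesgue_measure
    (`[c ord0 ord0, c ord0 ord0 + d[%classic : set (measurableTypeR R))) => //.
  by rewrite lebesgue_measure_itv/= lte_fin ltrDl d0 -EFinB expr1; congr EFin; ring.
pose c' : 'rV[R]_n.+1 := \row_j c ord0 (lift ord0 j).
have [m1 l1] := IH c'.
have E : @vec R n.+1 @^-1` box c d =
    (`[c ord0 ord0, c ord0 ord0 + d[%classic : set (measurableTypeR R)) `*`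
    (@vec R n @^-1` box c' d).
  apply/seteqP; split => p /=; rewrite in_itv/=.
    move=> h; split; first by have := h ord0; rewrite vecS0.
    by move=> i; have := h (lift ord0 i); rewrite vecSl mxE.
  move=> [h1 h2] i; case: (unliftP ord0 i) => [j ->|->]; last by rewrite vecS0.
  by rewrite vecSl; have := h2 j; rewrite mxE.
have mI : measurable (`[c ord0 ord0, c ord0 ord0 + d[%classic : set (measurableTypeR R)).
  exact: measurable_itv.
split; first by rewrite E; exact: measurableX.
rewrite /leb E.
pose J : set (measurableTypeR R) := `[c ord0 ord0, c ord0 ord0 + d[%classic.
transitivity (lebesgue_measure J * leb (box c' d))%E.
  exact: product_measure1E.
rewrite l1 /J lebesgue_measure_itv/= lte_fin ltrDl d0 -EFinB -EFinM [in RHS]exprS.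
by congr (_ * _)%:E; ring.
Qed.

Lemma measure_bigsetU_le {d} {T : measurableType d} {R : realType}
    (mu : {measure set T -> \bar R}) (I : Type) (s : seq I) (P : pred I) (F : I -> set T) c :
  (forall i, P i -> measurable (F i) /\ mu (F i) = c%:E) ->
  measurable (\big[setU/set0]_(i <- s | P i) F i) /\
  (mu (\big[setU/set0]_(i <- s | P i) F i) <= (\sum_(i <- s | P i) c)%:E)%E.
Proof.
move=> h; elim: s => [|i s [IH1 IH2]]; first by rewrite !big_nil measure0.
rewrite !big_cons; case: ifPn => // Pi; have [mi ci] := h i Pi.
split; first exact: measurableU.
rewrite EFinD -ci; apply: (le_trans (measureU2 mu mi IH1)).
exact: leeD2l.
Qed.

Section grid.
Context {R : realType} {n : nat}.
Variables (S : set 'rV[R]_n.+1) (M d : R) (K : nat).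

Definition corner (a : {ffun 'I_n.+1 -> 'I_K}) : 'rV[R]_n.+1 :=
  \row_i (- M + d * (a i : nat)%:R).

(** Made boolean so that the cubes meeting [S] can be counted and can index finite sums. *)
Definition meets_box (a : {ffun 'I_n.+1 -> 'I_K}) : bool :=
  `[< exists2 s, S s & box (corner a) d s >].

Lemma grid_cover x : 0 < d -> (forall x, S x -> forall i, `|x ord0 i| <= M) ->
  2 * M < d * K%:R -> S x -> exists2 a, meets_box a & box (corner a) d x.
Proof.
move=> d0 SM MK Sx.
have h (i : 'I_n.+1) : exists k : 'I_K,
    - M + d * (k : nat)%:R <= x ord0 i < - M + d * (k : nat)%:R + d.
  have := SM x Sx i; rewrite ler_norml => /andP[x1 x2].
  have y0 : 0 <= (x ord0 i + M) / d by rewrite divr_ge0 ?(ltW d0)//; lra.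
  have := truncn_itv y0 => /andP[k1 k2].
  (* The cell index is the integer part of [(x_i + M) / d], and this quotient is at most
     [2 * M / d < K]. *)
  have kK : (Num.truncn ((x ord0 i + M) / d) < K)%N.
    rewrite -(ltr_nat R); apply: (le_lt_trans k1).
    by rewrite ltr_pdivrMr// mulrC; apply: le_lt_trans MK; lra.
  exists (Ordinal kK) => /=.
  move: k1 k2; rewrite ler_pdivlMr// ltr_pdivrMr// -natr1 => k1 k2.
  by apply/andP; split; lra.
have /choice[a aP] := h.
have b : box (corner [ffun i => a i]) d x.
  by move=> i; rewrite mxE ffunE; exact: aP.
by exists [ffun i => a i] => //; apply/asboolP; exists x.
Qed.

Definition grid_union : set 'rV[R]_n.+1 :=
  [set x | exists2 a, meets_box a & box (corner a) d x].


Lemma grid_union_measure : 0 < d ->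
  measurable (@vec R n @^-1` grid_union) /\
  (leb grid_union <= (#|[pred a | meets_box a]|%:R * d ^+ n.+1)%:E)%E.
Proof.
move=> d0; have E : @vec R n @^-1` grid_union =
  \big[setU/set0]_(a | meets_box a) (@vec R n @^-1` box (corner a) d).
  apply/seteqP; split => x /=.
    by move=> [a ma xa]; rewrite (bigD1 a)//=; left.
  move=> h; have : exists2 a, meets_box a & (@vec R n @^-1` box (corner a) d) x.
    move: h; elim/big_ind : _ => //.
    - by move=> A B hA hB [/hA|/hB].
    - by move=> a ma xa; exists a.
  by [].
have [m l] := @measure_bigsetU_le _ _ _ (ls_mu (lspace R n)) _
  (index_enum _) meets_box (fun a => @vec R n @^-1` box (corner a) d) (d ^+ n.+1)
  (fun a _ => box_measure (corner a) d0).
rewrite /leb E; split => //; apply: (le_trans l).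
by rewrite sumr_const mulr_natl lexx.
Qed.

Lemma grid_union_close x : 0 < d -> grid_union x -> exists2 s, S s & `|x - s| <= d.
Proof.
move=> d0 [a /asboolP[s Ss sa] xa]; exists s => //.
apply: rV_norm_le; first exact: ltW.
move=> j; rewrite !mxE ler_norml.
have /andP[s1 s2] := sa j; have /andP[x1 x2] := xa j.
by apply/andP; split; lra.
Qed.

End grid.

Lemma compact_coord_bounded {R : realType} n (S : set 'rV[R]_n.+1) : compact S ->
  exists2 M, 0 < M & forall x, S x -> forall i, `|x ord0 i| <= M.
Proof.
move=> /compact_bounded[M [Mr hM]].
exists (Num.max 1 (M + 1)); first by rewrite lt_max ltr01.
move=> x Sx i; apply: (@le_trans _ _ `|x|).
  exact: rV_norm_coord_le.
by apply: hM => //; rewrite lt_max ltrDl ltr01 orbT.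
Qed.

(** The sigma-algebra on [lspace] is the product one, so [S] is exhibited as a countable
    intersection of finite unions of cubes, with sides [k.+1%:R^-1]; closedness of [S] gives the
    reverse inclusion. *)
Lemma measurable_compact {R : realType} n (S : set 'rV[R]_n.+1) : compact S ->
  measurable (@vec R n @^-1` S).
Proof.
move=> cS; have [M M0 SM] := compact_coord_bounded cS.
have clS : closed S by apply: compact_closed => //; exact: norm_hausdorff.
pose d k : R := k.+1%:R^-1.
have d0 k : 0 < d k by rewrite invr_gt0.
pose K k := (Num.truncn (2 * M / d k)).+1.
have MK k : 2 * M < d k * (K k)%:R.
  by rewrite [ltRHS]mulrC -ltr_pdivrMr//; exact: truncnS_gt.
have -> : @vec R n @^-1` S = \bigcap_k (@vec R n @^-1` grid_union S M (d k) (K k)).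
  apply/seteqP; split => x /=.
    move=> Sx k _ /=; have [a ma xa] := grid_cover (d0 k) SM (MK k) Sx.
    by exists a.
  move=> h; apply: clS => B /nbhs_ballP[e /= e0 eB].
  have [k _ kP] := near_infty_natSinv_lt (PosNum e0).
  have [s Ss xs] := grid_union_close (d0 k) (h k I).
  exists s; split => //; apply: eB; rewrite -ball_normE /=.
  by apply: (le_lt_trans xs); exact: (kP k (leqnn k)).
apply: bigcapT_measurable => k.
by have [] := @grid_union_measure R n S M (d k) (K k) (d0 k).
Qed.

(** The cubes meeting [S] cover it; this is where the measure of [S] becomes a lower bound on their
    number. *)
Lemma grid_count {R : realType} n (S : set 'rV[R]_n.+1) M d K : compact S ->
  0 < d -> (forall x, S x -> forall i, `|x ord0 i| <= M) -> 2 * M < d * K%:R ->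
  (leb S <= (#|[pred a | @meets_box R n S M d K a]|%:R * d ^+ n.+1)%:E)%E.
Proof.
move=> cS d0 SM MK; have [m l] := @grid_union_measure R n S M d K d0.
apply: le_trans l; apply: le_measure; rewrite ?inE//.
  exact: measurable_compact.
move=> x Sx /=; have [a ma xa] := grid_cover d0 SM MK Sx.
by exists a.
Qed.

(** * The transform pair of product tents and product [sinc2] functions *)

Lemma tensorN {R : realType} n (u : R -> R) (x : 'rV[R]_n.+1) : (forall t, u (- t) = u t) ->
  tensor u (- x) = tensor u x.
Proof. by move=> ue; apply: eq_bigr => i _; rewrite mxE ue. Qed.

Lemma integrable_tent {R : realType} (d : R) : 0 < d ->
  (@lebesgue_measure R).-integrable setT (EFin \o tent d).
Proof.
move=> d0; have := tent_mul_integrable d0 (@cst_continuous R R 1).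
by apply: eq_integrable => // x _; rewrite /= mulr1.
Qed.

Section tent_pair.
Context {R : realType} {n : nat} (d : R) (d0 : 0 < d).
Local Notation T := (@tensor R n (tent d)).
Local Notation V := (@tensor R n (sinc2 d)).

Lemma L1_tensor_tent : L1 T.
Proof. exact/L1_tensor/integrable_tent. Qed.

Lemma L1_tensor_sinc2 : L1 V.
Proof. exact/L1_tensor/integrable_sinc2. Qed.

Lemma fcos_tensor_tent : fcos T = V.
Proof.
apply/funext => xi; apply: (fourier_tensor xi (integrable_tent d0) (@tentN _ d) _).1.
by move=> t; exact: tent_cos.
Qed.

Lemma fsin_tensor_tent xi : fsin T xi = 0.
Proof. by apply: fsin_even; [move=> x; apply: tensorN; exact: tentN|exact: L1_tensor_tent]. Qed.

Lemma fcos_tensor_sinc2 : fcos V = T.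
Proof.
apply/funext => xi; apply: (fourier_tensor xi (integrable_sinc2 d0) (@sinc2N _ d) _).1.
by move=> t; exact: sinc2_cos.
Qed.

Lemma continuous_tensor_tent : continuous T.
Proof. by rewrite -fcos_tensor_sinc2; apply: continuous_fcos; exact: L1_tensor_sinc2. Qed.

End tent_pair.

(** * Autocorrelation of a union of cubes *)

Section corr.
Context {R : realType} {n : nat} (d : R) (d0 : 0 < d) (I : finType) (P : pred I)
  (c : I -> 'rV[R]_n.+1).
Local Notation T := (@tensor R n (tent d)).
Local Notation V := (@tensor R n (sinc2 d)).
Local Notation Q := (fun p : I * I => P p.1 && P p.2).
Local Notation cp := (fun p : I * I => c p.1 - c p.2).

Definition corr (x : 'rV[R]_n.+1) : R := \sum_(p : I * I | Q p) T (x - cp p).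
(** The sines contributed by the pairs (a, b) and (b, a) cancel, so only cosines remain. *)
Definition corr_hat (xi : 'rV[R]_n.+1) : R :=
  \sum_(p : I * I | Q p) V xi * cos (2 * pi * dotv (cp p) xi).

Lemma corr_swap x : corr x = \sum_(p : I * I | Q p) T (x + cp p).
Proof.
rewrite /corr (reindex_inj (h := fun p : I * I => (p.2, p.1))) /=; last first.
  by move=> [a b] [a' b'] [-> ->].
by apply: eq_big => [p|p _]; [rewrite andbC|rewrite opprB].
Qed.

Lemma corrN x : corr (- x) = corr x.
Proof.
rewrite corr_swap; apply: eq_bigr => p _.
by rewrite -[RHS](tensorN _ (@tentN _ d)) opprB addrC.
Qed.

Lemma corr_ge0 x : 0 <= corr x.
Proof. by apply: sumr_ge0 => p _; apply: prodr_ge0 => i _; exact: tent_ge0. Qed.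

Lemma corr_le x : corr x <= #|[pred p | Q p]|%:R.
Proof.
apply: (@le_trans _ _ (\sum_(p : I * I | Q p) 1)); last by rewrite sumr_const.
apply: ler_sum => p _; apply: prodr_ile1 => i _.
by rewrite tent_ge0 tent_le1.
Qed.

Lemma L1_corr : L1 corr.
Proof.
apply: L1_sum => p _.
have := L1_affine (- cp p) (oner_neq0 R) (L1_tensor_tent d0).
by apply: eq_integrable => // x _; rewrite scale1r.
Qed.

Lemma continuous_corr : continuous corr.
Proof.
apply: continuous_sum => p _ x.
apply: (cvg_comp (fun x => x - cp p) T); last exact: continuous_tensor_tent.
apply: (@continuousB _ _ _ id (fun=> cp p) x); first exact: cvg_id.
exact: cst_continuous.
Qed.

Lemma L1_corr_hat : L1 corr_hat.
Proof.
apply: L1_sum => p _; apply: L1_cos; exact: L1_tensor_sinc2.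
Qed.

Lemma dotvC (m : nat) (x y : 'rV[R]_m) : dotv x y = dotv y x.
Proof. by apply: eq_bigr => i _; rewrite mulrC. Qed.

Lemma fcos_corr : fcos corr = corr_hat.
Proof.
apply/funext => xi; rewrite /fcos /corr.
under [X in integ X]eq_fun do rewrite mulr_suml.
have L p : L1 (fun x => T (x - cp p)).
  have := L1_affine (- cp p) (oner_neq0 R) (L1_tensor_tent d0).
  by apply: eq_integrable => // x _; rewrite scale1r.
rewrite integ_sum => [|p _]; last exact: L1_cos.
apply: eq_bigr => p _; rewrite -/(fcos _ _) fcos_translate; last exact: L1_tensor_tent.
by rewrite fsin_tensor_tent// mul0r subr0 fcos_tensor_tent// dotvC.
Qed.

(** A product of two cosines is half a sum of cosines, so each term gives half of the two tents
    translated by [cp p] and by its opposite. Exchanging the members of each pair shows that the two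
    resulting sums agree. *)
Lemma fcos_corr_hat : fcos corr_hat = corr.
Proof.
apply/funext => xi; rewrite /fcos /corr_hat.
under [X in integ X]eq_fun do rewrite mulr_suml.
have LV : L1 V by exact: L1_tensor_sinc2.
rewrite integ_sum => [|p _]; last by do 2 apply: L1_cos.
transitivity (2^-1 * (\sum_(p : I * I | Q p) T (xi + cp p) + \sum_(p : I * I | Q p) T (xi - cp p))).
  rewrite -big_split /= mulr_sumr; apply: eq_bigr => p _.
  rewrite -fcos_tensor_sinc2// /fcos -integD; [|exact: L1_cos|exact: L1_cos].
  rewrite -integZ; last by apply: L1D; exact: L1_cos.
  move: (c p.1 - c p.2) => w; congr integ; apply/funext => x; rewrite ![dotv (xi + _) x]dotvC.
  rewrite !dotvDr dotvNr (mulrDr (2 * pi)) (mulrBr (2 * pi)) cosD cosB ![dotv x _]dotvC.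
  by field.
by rewrite -corr_swap -/(corr xi); field.
Qed.

Lemma continuous_corr_hat : continuous corr_hat.
Proof. by rewrite -fcos_corr; apply: continuous_fcos; exact: L1_corr. Qed.

Lemma corr_hatN x : corr_hat (- x) = corr_hat x.
Proof.
apply: eq_bigr => p _.
by rewrite dotvNr mulrN cosN tensorN//; exact: sinc2N.
Qed.

(** The double sum of cosines is the squared modulus of an exponential sum, here the square of a
    cosine sum plus the square of a sine sum. *)
Lemma corr_hat_ge0 x : 0 <= corr_hat x.
Proof.
rewrite /corr_hat -mulr_sumr mulr_ge0//.
  by apply: prodr_ge0 => i _; exact: sinc2_ge0.
pose ct a := cos (2 * pi * dotv x (c a)); pose st a := sin (2 * pi * dotv x (c a)).
have -> : \sum_(p : I * I | Q p) cos (2 * pi * dotv (cp p) x) =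
   (\sum_(a | P a) ct a) ^+ 2 + (\sum_(a | P a) st a) ^+ 2.
  rewrite !expr2 !big_distrlr /= !pair_big /= -big_split /=.
  by apply: eq_bigr => p _; rewrite dotvC dotvDr dotvNr mulrBr cosB.
by rewrite addr_ge0// sqr_ge0.
Qed.

Lemma corr_hat0 : corr_hat 0 = d ^+ n.+1 * #|[pred a | P a]|%:R ^+ 2.
Proof.
rewrite /corr_hat -mulr_sumr; congr (_ * _).
  rewrite /tensor; under eq_bigr do rewrite mxE sinc20.
  by rewrite prodr_const card_ord.
transitivity (\sum_(a | P a) \sum_(b | P b) (1 : R)).
  rewrite pair_big; apply: eq_bigr => p _.
  by rewrite -(scale0r 0) dotvZr mul0r mulr0 cos0.
by rewrite sumr_const sumr_const expr2 mulr_natr.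
Qed.

(** A pair of distinct cubes gives a tent that vanishes at 0 in some coordinate, so only the
    diagonal pairs survive, each contributing 1. *)
Lemma corr0 : (forall a b, a != b -> exists i, d <= `|c a ord0 i - c b ord0 i|) ->
  corr 0 = #|[pred a | P a]|%:R.
Proof.
move=> sep; rewrite /corr.
transitivity (\sum_(a | P a) \sum_(b | P b) T (0 - (c a - c b))).
  by rewrite pair_big.
rewrite -sumr_const; apply: eq_bigr => a Pa.
rewrite (bigD1 a)//= subrr subr0 big1 => [|b /andP[_ ba]].
  by rewrite addr0 /tensor big1// => i _; rewrite mxE tent0.
have [i di] := sep _ _ ba.
by rewrite /tensor (bigD1 i)//= !mxE tent_out ?mul0r// sub0r opprB.
Qed.

Lemma corr_support x : corr x != 0 -> exists a b,
  [/\ P a, P b & forall i, `|x ord0 i - (c a ord0 i - c b ord0 i)| <= d].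
Proof.
move=> bx; apply: contrapT => h; move/negP: bx; apply; apply/eqP.
apply: big1 => -[a b] /= /andP[Pa Pb].
have [i di] : exists i, d <= `|x ord0 i - (c a ord0 i - c b ord0 i)|.
  apply: contrapT => h'; apply: h; exists a, b; split => // i.
  by rewrite leNgt; apply/negP => di; apply: h'; exists i; exact: ltW.
by rewrite /tensor (bigD1 i)//= !mxE tent_out ?mul0r.
Qed.

End corr.

(** * Existence of the perturbing pair of functions *)

Lemma corner_separated {R : realType} n (M d : R) K (a b : {ffun 'I_n.+1 -> 'I_K}) :
  0 < d -> a != b -> exists i, d <= `|corner M d a ord0 i - corner M d b ord0 i|.
Proof.
move=> d0 ab.
have [i abi] : exists i, a i != b i.
  apply/existsP; rewrite -[X in is_true X]negbK negb_exists; apply/negP => /forallP h.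
  move/negP: ab; apply; apply/eqP/ffunP => i.
  by apply/eqP; rewrite -[_ == _]negbK; exact: h.
exists i; rewrite !mxE.
rewrite opprD addrACA subrr add0r -mulrBr.
rewrite normrM (gtr0_norm d0) ler_peMr ?(ltW d0)//.
have h k l : (k < l)%N -> 1 <= `|k%:R - l%:R : R|.
  move=> kl; rewrite distrC -(natrB _ (ltnW kl)) normr_nat ler1n subn_gt0.
  exact: kl.
have : (a i < b i)%N \/ (b i < a i)%N.
  apply/orP; rewrite -neq_ltn; apply: contra abi => /eqP abi.
  exact/eqP/val_inj.
move=> [ab'|ab'].
  exact: (h _ _ ab').
rewrite distrC.
exact: (h _ _ ab').
Qed.

(** One [d] accounts for the half-width of the tent, and one for the offset of each of [s] and [t]
    within its cube. *)
Lemma box_sub_close {R : realType} n (c1 c2 s t x : 'rV[R]_n.+1) d : 0 < d ->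
  box c1 d s -> box c2 d t ->
  (forall i, `|x ord0 i - (c1 ord0 i - c2 ord0 i)| <= d) ->
  `|x - (s - t)| <= 3 * d.
Proof.
move=> d0 sc tc xc; apply: rV_norm_le; first by rewrite mulr_ge0// ltW.
move=> i; rewrite !mxE; have := xc i; rewrite !ler_norml => /andP[x1 x2].
have /andP[s1 s2] := sc i; have /andP[t1 t2] := tc i.
by apply/andP; split; lra.
Qed.

(** [H] and [Hh] are each other's transforms, so one pair serves both halves of the theorem: [H] is
    added to [f] in one and subtracted from the transform of [f] in the other. *)
Lemma exists_bump {R : realType} n (S : set 'rV[R]_n.+1) e :
  compact S -> (1 < leb S)%E -> 0 < e ->
  exists H Hh : 'rV[R]_n.+1 -> R, exists2 B : R,
  [/\ continuous H /\ continuous Hh,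
      (forall x, H (- x) = H x) /\ (forall x, Hh (- x) = Hh x),
      L1 H /\ L1 Hh, fcos H = Hh /\ fcos Hh = H &
      [/\ forall x, 0 <= H x, forall x, 0 <= Hh x, H 0 < Hh 0 & forall x, H x <= B]] &
  forall x, H x != 0 -> exists2 z, setdiffs S S z & `|x - z| < e.
Proof.
move=> cS S1 e0; have [M M0 SM] := compact_coord_bounded cS.
(* Any side with [3 * d < e] puts the support of [H] within [e] of the difference set. *)
pose d := e / 4.
have d0 : 0 < d by rewrite divr_gt0.
pose K := (Num.truncn (2 * M / d)).+1.
have MK : 2 * M < d * K%:R.
  by rewrite [ltRHS]mulrC -ltr_pdivrMr//; exact: truncnS_gt.
pose P := @meets_box R n S M d K.
pose c := @corner R n M d K.
have count := grid_count cS d0 SM MK.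
have m1 : 1 < #|[pred a | P a]|%:R * d ^+ n.+1.
  by rewrite -lte_fin; apply: lt_le_trans count.
have m0 : 0 < #|[pred a | P a]|%:R :> R.
  rewrite lt_neqAle ler0n andbT eq_sym; apply/negP => /eqP m0.
  by move: m1; rewrite m0 mul0r ltr10.
exists (corr d P c), (corr_hat d P c), #|[pred p : _ * _ | P p.1 && P p.2]|%:R.
  split.
  - by split; [exact: continuous_corr|exact: continuous_corr_hat].
  - by split => x; [exact: corrN|exact: corr_hatN].
  - by split; [exact: L1_corr|exact: L1_corr_hat].
  - by split; [exact: fcos_corr|exact: fcos_corr_hat].
  - split => [x|x||x].
    + exact: corr_ge0.
    + exact: corr_hat_ge0.
    (* With [m] cubes the claim is [m < d ^+ n.+1 * m ^+ 2], that is, [m1] multiplied by [m]. *)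
    + rewrite corr_hat0 corr0//.
        by rewrite expr2 mulrA ltr_pMl// mulrC.
      by move=> a b; exact: corner_separated.
    + exact: corr_le.
move=> x /(corr_support d0)[a [b [/asboolP[s Ss sa] /asboolP[t St tb] xab]]].
exists (s - t); first by exists s, t.
apply: (le_lt_trans (box_sub_close d0 sa tb xab)).
by rewrite /d mulrCA gtr_pMr// ltr_pdivrMr// mul1r ltr_nat.
Qed.

(** * The two perturbation arguments *)

(* The ambient dimension is n.+1 (i.e. every dimension >= 1);
   points of R^(n+1) are row vectors 'rV[R]_n.+1. *)
Theorem theorem1p2 (R : realType) (n : nat) (f : 'rV[R]_n.+1 -> R)
    (S : set 'rV[R]_n.+1) :
  cohn_elkies f -> radial f ->
  compact S -> (1 < leb S)%E ->
  (exists2 z, setdiffs S S z & rf f <= enorm z /\ f z = 0) /\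
  (exists2 z', setdiffs S S z' & fourier f z' = 0).
Proof.
move=> [Ff rfE] _ cS S1; have cD := compact_setdiffs cS.
have r0 := rf_gt0 Ff.
have [[cf fe Lf [Lfh _]] f0h f0 fh0 _] := Ff.
have Lfc : L1 (fcos f).
  by apply: eq_integrable Lfh => // x _; rewrite Re_fourier.
have f0E : fcos f 0 = f 0 by rewrite -Re_fourier -f0h.
have fs xi : fsin f xi = 0 by move: (fh0 xi); rewrite fourier_ge0 => /andP[/eqP].
have fc xi : 0 <= fcos f xi by move: (fh0 xi); rewrite fourier_ge0 => /andP[].
split; apply: contrapT => h.
(* A lower bound [e <= psi x] says that [f x <= - e] or that [x] lies inside the sphere of radius
   [rf f]. On the difference set [psi] is positive exactly because the sought zero is assumed not to
   exist. *)
- pose psi x := Num.max (- f x) (rf f - enorm x).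
  have cpsi : continuous psi.
    move=> x; apply: (@continuous_max R _ (fun x => - f x) (fun x => rf f - enorm x)).
      exact: (cvgN (cf x)).
    exact: (cvgB (cvg_cst _) (@continuous_enorm R n x)).
  have psi0 z : setdiffs S S z -> 0 < psi z.
    move=> Dz; rewrite lt_max subr_gt0 oppr_gt0; case: (ltP (enorm z) (rf f)) => rz.
      by rewrite orbT.
    rewrite orbF lt_neqAle le0_beyond_rf// andbT; apply/eqP => fz.
    by apply: h; exists z.
  have [e e0 he] := compact_gt0_thickening cD cpsi psi0.
  have [H [Hh [B [[cH cHh] [He Hhe] [LH LHh] [HE HhE] [H0 Hh0 H0h HB]] supp]]] :=
    exists_bump cS S1 e0.
  have B0 : 0 <= B := le_trans (H0 0) (HB 0).
  have B1 : 0 < B + 1 by rewrite ltr_wpDl.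
  (* Small enough that [k * H] never exceeds [e]; the added 1 keeps the denominator positive. *)
  pose k := e / (B + 1).
  have k0 : 0 < k by rewrite divr_gt0.
  have kB x : k * H x <= e.
    rewrite /k mulrAC ler_pdivrMr// ler_pM2l//.
    by apply: (le_trans (HB x)); rewrite lerDl.
  pose g x := f x + k * H x.
  have gE : fcos g = fun xi => fcos f xi + k * Hh xi.
    by apply/funext => xi; rewrite fcosDZ// HE.
  have : Rdim R n < rf f.
    apply: (@Rdim_lt _ _ g).
    + move=> x; apply: (@continuousD _ _ _ f (fun x => k * H x) x (cf x)).
      by apply: (@continuousM R _ (fun=> k) H x); [exact: cst_continuous|exact: cH].
    + by move=> x; rewrite /g fe He.
    + by apply: L1D => //; exact: L1Z.
    + by rewrite gE; apply: L1D => //; exact: L1Z.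
    + by move=> xi; rewrite gE addr_ge0// mulr_ge0// ltW.
    + by rewrite /g ltr_pwDl// mulr_ge0// ltW.
    + by rewrite gE f0E /g ltrD2l ltr_pM2l.
    (* Where [H] is nonzero, [x] is within [e] of the difference set, so [e <= psi x]; as
       [rf f <= enorm x], this forces [f x <= - e], which absorbs [k * H x]. *)
    + move=> x rx; rewrite /g; have [->|Hx] := eqVneq (H x) 0.
        by rewrite mulr0 addr0 le0_beyond_rf.
      have [z Dz xz] := supp x Hx.
      have := he z x Dz xz; rewrite le_max => /orP[|]; last by lra.
      by have := kB x; lra.
  by rewrite rfE ltxx.
- have psi0 z : setdiffs S S z -> 0 < fcos f z.
    move=> Dz; rewrite lt_neqAle fc andbT eq_sym; apply/eqP => fz.
    by apply: h; exists z => //; rewrite fourierE fs fz oppr0.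
  have [e e0 he] := compact_gt0_thickening cD (continuous_fcos Lf) psi0.
  have [H [Hh [B [[cH cHh] [He Hhe] [LH LHh] [HE HhE] [H0 Hh0 H0h HB]] supp]]] :=
    exists_bump cS S1 e0.
  have B0 : 0 <= B := le_trans (H0 0) (HB 0).
  have B1 : 0 < B + 1 by rewrite ltr_wpDl.
  have Hh1 : 0 < Hh 0 + 1 by rewrite ltr_wpDl.
  (* The first bound keeps the perturbed transform nonnegative, the second keeps the perturbed
     function positive at 0. *)
  pose k := Num.min (e / (B + 1)) (f 0 / (Hh 0 + 1)).
  have k0 : 0 < k by rewrite lt_min !divr_gt0.
  have kB x : k * H x <= e.
    apply: (@le_trans _ _ (e / (B + 1) * H x)).
      by rewrite ler_wpM2r// ge_min lexx.
    rewrite mulrAC ler_pdivrMr// ler_pM2l//.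
    by apply: (le_trans (HB x)); rewrite lerDl.
  have kf : k * Hh 0 < f 0.
    apply: (@le_lt_trans _ _ (f 0 / (Hh 0 + 1) * Hh 0)).
      by rewrite ler_wpM2r// ge_min lexx orbT.
    by rewrite mulrAC ltr_pdivrMr// ltr_pM2l// ltrDl.
  (* Both values at 0 decrease, but the transform loses only [k * H 0], less than the [k * Hh 0]
     lost by the function. *)
  pose g x := f x + (- k) * Hh x.
  have gE : fcos g = fun xi => fcos f xi + (- k) * H xi.
    by apply/funext => xi; rewrite fcosDZ// HhE.
  have : Rdim R n < rf f.
    apply: (@Rdim_lt _ _ g).
    + move=> x; apply: (@continuousD _ _ _ f (fun x => - k * Hh x) x (cf x)).
      by apply: (@continuousM R _ (fun=> - k) Hh x); [exact: cst_continuous|exact: cHh].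
    + by move=> x; rewrite /g fe Hhe.
    + by apply: L1D => //; exact: L1Z.
    + by rewrite gE; apply: L1D => //; exact: L1Z.
    + move=> xi; rewrite gE; have [->|Hx] := eqVneq (H xi) 0.
        by rewrite mulr0 addr0.
      have [z Dz xz] := supp xi Hx.
      by have := he z xi Dz xz; have := kB xi; lra.
    + by rewrite /g; lra.
    + by rewrite gE f0E /g ltrD2l !mulNr ltrN2 ltr_pM2l.
    (* Subtracting a nonnegative function preserves the sign condition at the same radius. *)
    + move=> x rx; rewrite /g mulNr; apply: (@le_trans _ _ (f x)).
        by rewrite gerBl mulr_ge0// ltW.
      exact: le0_beyond_rf.
  by rewrite rfE ltxx.
Qed.
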